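(* Let $R$ be an integral domain with fraction field $F$ of characteristic $0$, $C$ an associative composition algebra over $R$, and $J=H_3(C)$. Let $(A,B)\in J^2$ with $Q=Q(f_{(A,B)})\neq0$, so that $L=T\otimes_RF$ is étale. Let $X$, $Y$ and $\epsilon$ be as in the context. Then for every row vector $v\in C^3$, $$Q\,(v\epsilon)^*(v\epsilon)=(vYv^* )\,X.$$
   Context: **Composition algebras.** An associative composition algebra over $R$ is an associative $R$-algebra $C$, free of finite rank, stable under the standard involution $x\mapsto x^*$ of $C_F$, where $C_F$ is $F$, a quadratic étale $F$-algebra, or a quaternion $F$-algebra. Write $n_C(x)=xx^*$ and $\tr_C(x)=x+x^*$. **Hermitian matrices.** $H_3(C)$ is the set of Hermitian $3\times3$ matrices over $C$ ($^*$ = conjugate transpose). For $x$ with diagonal entries $c_1,c_2,c_3$ and off-diagonal entries $x_{12}=a_3$, $x_{13}=a_2^*$, $x_{23}=a_1$, the norm is $$n(x)=c_1c_2c_3-\sum c_in_C(a_i)+\tr_C(a_1a_2a_3).$$ The adjoint is $x^\#=n(x)x^{-1}$ (extended polynomially). The pairing is $(x,x')=\sum c_ic_i'+\sum\tr_C(a_j^*a_j')$, and $x\times y=(x+y)^\#-x^\#-y^\#$. **Cubic rings.** For $f=ax^3+bx^2y+cxy^2+dy^3$, the based cubic ring $T$ has basis $(1,\omega,\theta)$ with $$\omega\theta=-ad,\qquad \omega^2=-ac+a\theta-b\omega,\qquad \theta^2=-bd+c\theta-d\omega.$$ Its discriminant is $$Q(f)=-27a^2d^2+18abcd+b^2c^2-4ac^3-4b^3d.$$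 Here $f=f_{(A,B)}=n(A)x^3+(A^\#,B)x^2y+(A,B^\#)xy^2+n(B)y^3$. On $T$, $\lambda^\#=\lambda^2-t_1(\lambda)\lambda+t_2(\lambda)$ (coefficients of the characteristic polynomial) and $\lambda\times\mu=(\lambda+\mu)^\#-\lambda^\#-\mu^\#$. **The elements $X$ and $Y$.** Set $X=-A\theta+B\omega+A^\#\times B^\#\in J\otimes T$ and $Y=\frac12X\times_TX$, where $(U_1\otimes\lambda_1)\times_T(U_2\otimes\lambda_2)=(U_1\times U_2)\otimes(\lambda_1\times\lambda_2)$. **The element $\epsilon$.** Let $S_r:T\to M_3(C)$ be $R$-linear with $S_r(1)=1$, $S_r(\omega)=-A^\#B$, $S_r(\theta)=B^\#A$ (an algebra homomorphism). With $\{v_\alpha\}$ an $R$-basis of $T$ and $\{w_\alpha\}$ the dual basis of $L$ for the trace form $\tr_{L/F}(xy)$, set $$\epsilon=\sum_\alpha S_r(v_\alpha)\otimes w_\alpha\in M_3(C)\otimes_RL.$$ Then $v\epsilon$ is a row vector in $C_L^3$, and $(v\epsilon)^*(v\epsilon)\in H_3(C)\otimes L$. *)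

(* Defs.v *)
From HB Require Import structures.
From mathcomp Require Import all_boot all_order all_algebra all_field.
From mathcomp Require Import ring.
From mathcomp Require Import boolp classical_sets.

Set Implicit Arguments.
Unset Strict Implicit.
Unset Printing Implicit Defensive.

Import GRing.Theory.
Local Open Scope ring_scope.

Local Notation "x %:F" := (tofrac x) : ring_scope.

Definition free_basis (K : nzRingType) (V : lmodType K) (n : nat)
    (e : 'I_n -> V) : Prop :=
  forall x : V, exists! c : {ffun 'I_n -> K}, x = \sum_i c i *: e i.

Section CompositionAlgebras.
Variables (F : fieldType) (D : falgType F).

(* The trace of multiplication by [x] on [D]. *)
Definition alg_trace (x : D) : F :=
  \sum_(i < \dim {:D}) coord (vbasis {:D}) i (x * (vbasis {:D})`_i).

(* Etale = commutative with nondegenerate trace form. *)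
Definition etale : Prop :=
  (forall x y : D, x * y = y * x) /\
  (forall x : D, (forall y, alg_trace (x * y) = 0) -> x = 0).

Definition quadratic_etale : Prop := \dim {:D} = 2%N /\ etale.

(* Only used over a field of characteristic different from 2. *)
Definition quaternion : Prop :=
  exists (p q : F) (i j : D),
    [/\ p != 0, q != 0,
        [/\ i * i = p%:A, j * j = q%:A & i * j = - (j * i)]
      & basis_of {:D} [:: 1; i; j; i * j]].

(* On [F], on a quadratic etale algebra and on a quaternion algebra (in
   characteristic different from 2) there is exactly one such map. *)
Record standard_involution (s : D -> D) : Prop := StandardInvolution {
  std_linear : linear s;
  std_one : s 1 = 1;
  std_mul : forall x y, s (x * y) = s y * s x;
  std_inv : involutive s;
  std_norm : forall x, exists r : F, x * s x = r%:A
}.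

End CompositionAlgebras.

(* [ca_frac] is the base change of [ca_int] to the fraction field, along
   [ca_map]: some (equivalently, every) R-basis of [ca_int] is mapped to a
   basis of [ca_frac].  [ca_star] is the restriction of the standard
   involution, under which [ca_int] is thus stable. *)
Record comp_algebra (R : idomainType) := CompAlgebra {
  ca_int :> algType R;
  ca_frac : falgType {fraction R};
  ca_map : {rmorphism ca_int -> ca_frac};
  ca_mapZ : forall (r : R) (x : ca_int), ca_map (r *: x) = r%:F *: ca_map x;
  ca_free : exists (n : nat) (e : 'I_n -> ca_int),
    free_basis e /\ basis_of {:ca_frac} [seq ca_map (e i) | i <- enum 'I_n];
  ca_kind : [\/ \dim {:ca_frac} = 1%N, quadratic_etale ca_frac
             | quaternion ca_frac];
  ca_starF : ca_frac -> ca_frac;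
  ca_starFP : standard_involution ca_starF;
  ca_star : ca_int -> ca_int;
  ca_map_star : forall x, ca_map (ca_star x) = ca_starF (ca_map x)
}.

Arguments ca_map {R c}.

(* [ctrmx s A] is the conjugate transpose of [A] with respect to [s]. *)
Definition ctrmx (D : Type) (s : D -> D) (m n : nat) (A : 'M[D]_(m, n)) :
    'M[D]_(n, m) := (map_mx s A)^T.

Section Hermitian.
Variables (R : idomainType) (C : comp_algebra R).
Implicit Types (x y : C) (A B : 'M[C]_3).

Local Notation "x ^*" := (ca_star x) : ring_scope.

(* The scalar [r] with [x = r%:A]; junk when [x] is not in [R]. It is applied
   only to elements of [R]: see lemmas [nCE], [trCE] and [scalK_diag]. *)
Definition scal x : R := xget 0 [set r : R | r%:A = x]%classic.

Definition nC x : R := scal (x * x^*).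
Definition trC x : R := scal (x + x^*).

Definition is_hermitian A : Prop := ctrmx (@ca_star R C) A = A.

(* Indices are those of 'I_3, so that [A 0 1] is the entry x_{12}, and so on. *)
Definition hc1 A : R := scal (A 0 0).
Definition hc2 A : R := scal (A 1 1).
Definition hc3 A : R := scal (A 2 2).
Definition ha1 A : C := A 1 2.
Definition ha2 A : C := (A 0 2)^*.
Definition ha3 A : C := A 0 1.

Definition herm3 (r1 r2 r3 : R) (x1 x2 x3 : C) : 'M[C]_3 :=
  \matrix_(i < 3, j < 3) nth 0 (nth [::]
    [:: [:: r1%:A; x3   ; x2^* ];
        [:: x3^* ; r2%:A; x1   ];
        [:: x2   ; x1^* ; r3%:A] ] i) j.

Definition normH A : R :=
  hc1 A * hc2 A * hc3 A
  - (hc1 A * nC (ha1 A) + hc2 A * nC (ha2 A) + hc3 A * nC (ha3 A))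
  + trC (ha1 A * ha2 A * ha3 A).

(* The polynomial extension of [normH A *: A^-1]; see lemma [mulmx_adjH]. *)
Definition adjH A : 'M[C]_3 :=
  herm3 (hc2 A * hc3 A - nC (ha1 A))
        (hc3 A * hc1 A - nC (ha2 A))
        (hc1 A * hc2 A - nC (ha3 A))
        ((ha2 A * ha3 A)^* - hc1 A *: ha1 A)
        ((ha3 A * ha1 A)^* - hc2 A *: ha2 A)
        ((ha1 A * ha2 A)^* - hc3 A *: ha3 A).

Definition pairH A B : R :=
  (hc1 A * hc1 B + hc2 A * hc2 B + hc3 A * hc3 B)
  + (trC ((ha1 A)^* * ha1 B) + trC ((ha2 A)^* * ha2 B) + trC ((ha3 A)^* * ha3 B)).

Definition crossH A B : 'M[C]_3 := adjH (A + B) - adjH A - adjH B.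

End Hermitian.

Section HermitianTheory.
Variables (R : idomainType) (C : comp_algebra R).
Local Notation F := {fraction R}.
Local Notation "x ^*" := (ca_star x) : ring_scope.

Lemma ca_mapA (r : R) : ca_map (r%:A : C) = (r%:F)%:A.
Proof. by rewrite ca_mapZ rmorph1. Qed.

Lemma ca_map_inj : injective (@ca_map R C).
Proof.
apply: raddf_inj => x; have [n [e [eP bE]]] := ca_free C.
have [c [-> _]] := eP x; rewrite raddf_sum => /= E0.
apply: big1 => i _; suff -> : c i = 0 by rewrite scale0r.
have sE : size [seq ca_map (e j) | j <- enum 'I_n] == n.
  by rewrite size_map size_enum_ord.
have fE : free (Tuple sE) by case/andP: bE.
have tE (j : 'I_n) : (Tuple sE)`_j = ca_map (e j).
  by rewrite (nth_map j) ?size_enum_ord // nth_ord_enum.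
move/freeP: fE => /(_ (fun j => (c j)%:F)) /(_ _ i) cE; apply/eqP.
rewrite -(@tofrac_eq0 R) cE // -[RHS]E0; apply: eq_bigr => j _.
by rewrite ca_mapZ tE.
Qed.

(* The intersection of C with F is R, because C is free over R. *)
Lemma ca_map_scalar (x : C) (q : F) :
  ca_map x = q%:A -> exists r : R, x = r%:A.
Proof.
move=> xq; have [n [e [eP bE]]] := ca_free C.
have sE : size [seq ca_map (e j) | j <- enum 'I_n] == n.
  by rewrite size_map size_enum_ord.
have fE : free (Tuple sE) by case/andP: bE.
have tE (j : 'I_n) : (Tuple sE)`_j = ca_map (e j).
  by rewrite (nth_map j) ?size_enum_ord // nth_ord_enum.
case: n => [|n] in e eP bE sE fE tE *.
  have [c [/eqP]] := eP 1; by rewrite big_ord0 oner_eq0.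
have [c [cE _]] := eP (x * e ord0); exists (c ord0); apply: ca_map_inj.
rewrite ca_mapA xq; congr (_ *: _); apply/eqP; rewrite -subr_eq0; apply/eqP.
move/freeP: fE.
move=> /(_ (fun j => q * (j == ord0)%:R - (c j)%:F)) /(_ _ ord0).
rewrite /= ?eqxx ?mulr1. apply; under eq_bigr => j _ do rewrite scalerBl tE.
rewrite sumrB (bigD1 ord0) //= ?eqxx mulr1 big1 ?addr0 => [|j /negPf->]; last first.
  by rewrite mulr0 scale0r.
apply/eqP; rewrite subr_eq0; apply/eqP.
transitivity (ca_map (x * e ord0)); first by rewrite rmorphM xq /= -scalerAl mul1r.
by rewrite cE raddf_sum; apply: eq_bigr => j _; rewrite /= ca_mapZ.
Qed.

Lemma scalK (x : C) : (exists r : R, x = r%:A) -> (scal x)%:A = x.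
Proof.
case=> r ->; rewrite /scal.
exact: (@xgetPex _ 0 [set s : R | s%:A = r%:A :> C]%classic (ex_intro _ r erefl)).
Qed.

Lemma nCE (x : C) : (nC x)%:A = x * x^*.
Proof.
apply: scalK; have [q qE] := std_norm (ca_starFP C) (ca_map x).
by apply: (@ca_map_scalar _ q); rewrite rmorphM ca_map_star.
Qed.

Lemma ca_starD (x y : C) : (x + y)^* = x^* + y^*.
Proof.
apply: ca_map_inj; rewrite !(ca_map_star, rmorphD) /=.
by have := std_linear (ca_starFP C) 1 (ca_map x) (ca_map y); rewrite !scale1r.
Qed.

Lemma ca_star1 : (1 : C)^* = 1.
Proof.
by apply: ca_map_inj; rewrite ca_map_star rmorph1 (std_one (ca_starFP C)).
Qed.

Lemma ca_starM (x y : C) : (x * y)^* = y^* * x^*.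
Proof.
by apply: ca_map_inj; rewrite !(ca_map_star, rmorphM) (std_mul (ca_starFP C)).
Qed.

Lemma ca_starK : involutive (@ca_star R C).
Proof.
by move=> x; apply: ca_map_inj; rewrite !ca_map_star (std_inv (ca_starFP C)).
Qed.

Lemma ca_starZ (r : R) (x : C) : (r *: x)^* = r *: x^*.
Proof.
apply: ca_map_inj; rewrite !(ca_map_star, ca_mapZ).
have [s0 sl] : ca_starF (0 : ca_frac C) = 0 /\ True.
  split=> //; have := std_linear (ca_starFP C) (-1) 0 0.
  by rewrite !scaleN1r oppr0 addr0 addNr.
have := std_linear (ca_starFP C) r%:F (ca_map x) 0.
by rewrite s0 !addr0.
Qed.

Lemma trCE (x : C) : (trC x)%:A = x + x^*.
Proof.
apply: scalK; exists (nC (1 + x) - 1 - nC x).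
rewrite !scalerBl !nCE scale1r ca_starD ca_star1 mulrDl mul1r mulrDr mulr1.
symmetry; apply/eqP; rewrite -addrA -opprD subr_eq; apply/eqP.
by rewrite addrACA [RHS]addrACA [1 + x]addrC.
Qed.

Lemma scalK_diag (charF : [pchar F] =i pred0) (A : 'M[C]_3) i :
  is_hermitian A -> (scal (A i i))%:A = A i i.
Proof.
move=> hA; apply: scalK; have sA : (A i i)^* = A i i.
  by rewrite -{2}hA !mxE.
apply: (@ca_map_scalar _ ((trC (A i i))%:F / 2%:R)).
have := congr1 (@ca_map R C) (trCE (A i i)); rewrite ca_mapA sA rmorphD => E.
have n2 : (2%:R : F) != 0 by rewrite ((pcharf0P _).1 charF).
by rewrite mulrC -scalerA E -mulr2n -scaler_nat scalerA mulVf ?scale1r.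
Qed.

Lemma nCC (x : C) : x^* * x = (nC x)%:A.
Proof.
have xC : x * x^* = x^* * x.
  have -> : x^* = (trC x)%:A - x by rewrite trCE addrC addKr.
  by rewrite mulrBr mulrBl -scalerAr -scalerAl mulr1 mul1r.
by rewrite nCE xC.
Qed.

Lemma trCC (x y : C) : trC (x * y) = trC (y * x).
Proof.
have E (u v : C) : (trC (u * v))%:A =
    u * v + v * u + ((trC v * trC u)%:A - (trC v *: u + trC u *: v)).
  have sE (z : C) : z^* = (trC z)%:A - z by rewrite trCE addrC addKr.
  rewrite trCE ca_starM (sE v) (sE u) mulrBl !mulrBr -!scalerAl -!scalerAr.
  rewrite !mul1r !mulr1 scalerA -[RHS]addrA; congr (_ + _).
  by rewrite opprB opprD !addrA [v * u + _]addrC; congr (_ - _); rewrite addrAC.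
have sc_inj : injective (fun r : R => r%:A : C).
  move=> r s /(congr1 (@ca_map R C)); rewrite !ca_mapA => /eqP.
  rewrite -subr_eq0 -scalerBl scaler_eq0 oner_eq0 orbF subr_eq0.
  by rewrite tofrac_eq => /eqP.
by apply: sc_inj; rewrite !E; congr (_ + (_ - _)); rewrite 1?mulrC // addrC.
Qed.

Let adj_diag (r1 r2 r3 : R) (x1 x2 x3 : C) :
  r1%:A * (r2 * r3 - nC x1)%:A + x3 * ((x1 * x2)^* - r3 *: x3)^*
    + x2^* * ((x3 * x1)^* - r2 *: x2) =
  (r1 * r2 * r3 - (r1 * nC x1 + r2 * nC x2 + r3 * nC x3)
    + trC (x1 * x2 * x3))%:A.
Proof.
have -> : ((x1 * x2)^* - r3 *: x3)^* = x1 * x2 - r3 *: x3^*.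
  by rewrite -[- (r3 *: x3)]scaleNr ca_starD ca_starK ca_starZ scaleNr.
rewrite !mulrBr -!scalerAr -nCE nCC -ca_starM mulr1 !scalerA.
have -> : (x3 * x1 * x2)^* = (trC (x1 * x2 * x3))%:A - x3 * (x1 * x2).
  by rewrite trCC mulrA trCE addrC addKr.
set u := x3 * _; set S := (trC _).
rewrite addrA addrAC -!addrA [u + _]addrC !addrA.
rewrite subrK -!scalerBl -scalerDl; congr (_ *: _); ring.
Qed.

Let adj_up (r1 r2 r3 : R) (x1 x2 x3 : C) :
  r1%:A * ((x1 * x2)^* - r3 *: x3) + x3 * (r3 * r1 - nC x2)%:A
    + x2^* * ((x2 * x3)^* - r1 *: x1)^* = 0.
Proof.
have -> : ((x2 * x3)^* - r1 *: x1)^* = x2 * x3 - r1 *: x1^*.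
  by rewrite -[- (r1 *: x1)]scaleNr ca_starD ca_starK ca_starZ scaleNr.
rewrite !mulrBr -!scalerAr -scalerAl mul1r mulr1 mulrA nCC -scalerAl mul1r.
rewrite -ca_starM scalerA scalerBl [r3 * r1]mulrC -[_%:A * _]scalerAl mul1r.
by rewrite !addrA !subrK subrr.
Qed.

Let adj_down (r1 r2 r3 : R) (x1 x2 x3 : C) :
  x3^* * (r2 * r3 - nC x1)%:A + r2%:A * ((x1 * x2)^* - r3 *: x3)^*
    + x1 * ((x3 * x1)^* - r2 *: x2) = 0.
Proof.
have -> : ((x1 * x2)^* - r3 *: x3)^* = x1 * x2 - r3 *: x3^*.
  by rewrite -[- (r3 *: x3)]scaleNr ca_starD ca_starK ca_starZ scaleNr.
rewrite !mulrBr -!scalerAr -scalerAl mul1r mulr1 ca_starM mulrA -nCE.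
rewrite -scalerAl mul1r scalerA scalerBl -[_%:A * _]scalerAl mul1r.
by rewrite [r3 * r2]mulrC [X in X + _]addrC !addrA !subrK subrr.
Qed.

Lemma mulmx_adjH (charF : [pchar F] =i pred0) (A : 'M[C]_3) :
  is_hermitian A -> A *m adjH A = ((normH A)%:A)%:M.
Proof.
move=> hA; have hs i j : A i j = (A j i)^* by rewrite -{1}hA !mxE.
have dA i : A i i = (scal (A i i))%:A by rewrite (scalK_diag charF).
set x1 := ha1 A; set x2 := ha2 A; set x3 := ha3 A.
set r1 := hc1 A; set r2 := hc2 A; set r3 := hc3 A.
have AE : A = herm3 r1 r2 r3 x1 x2 x3.
  apply/matrixP => i j; rewrite !mxE.
  case: i => -[|[|[|//]]] iP; case: j => -[|[|[|//]]] jP /=;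
  rewrite /r1 /r2 /r3 /x1 /x2 /x3 /hc1 /hc2 /hc3 /ha1 /ha2 /ha3 -?hs -?dA;
  congr (A _ _); exact: val_inj.
rewrite {1}AE /adjH /normH -/x1 -/x2 -/x3 -/r1 -/r2 -/r3.
apply/matrixP => i j; rewrite !mxE !big_ord_recl big_ord0 !mxE addr0 addrA.
case: i => -[|[|[|//]]] iP; case: j => -[|[|[|//]]] jP /=;
  rewrite ?mulr0n ?mulr1n.
- exact: adj_diag.
- exact: adj_up.
- by rewrite addrC addrA adj_down.
- exact: adj_down.
- rewrite -addrA addrC adj_diag [X in X%:A](_ : _ = normH A) //.
  rewrite /normH -/x1 -/x2 -/x3 -/r1 -/r2 -/r3 -(mulrA x1) (trCC x1).
  by congr (_ + _); ring.
- by rewrite -addrA addrC adj_up.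
- by rewrite addrC addrA adj_up.
- by rewrite -addrA addrC adj_down.
- rewrite addrC addrA adj_diag [X in X%:A](_ : _ = normH A) //.
  rewrite /normH -/x1 -/x2 -/x3 -/r1 -/r2 -/r3 (trCC _ x3) (mulrA x3).
  by congr (_ + _); ring.
Qed.

End HermitianTheory.

(* The binary cubic form a x^3 + b x^2 y + c x y^2 + d y^3. *)
Record cubic_form (K : Type) := CubicForm { fa : K; fb : K; fc : K; fd : K }.

Definition map_form (K K' : Type) (g : K -> K') (f : cubic_form K) :=
  CubicForm (g (fa f)) (g (fb f)) (g (fc f)) (g (fd f)).

Definition disc (K : comNzRingType) (f : cubic_form K) : K :=
  let: CubicForm a b c d := f in
  - 27 * a ^+ 2 * d ^+ 2 + 18 * a * b * c * d + b ^+ 2 * c ^+ 2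
  - 4 * a * c ^+ 3 - 4 * b ^+ 3 * d.

(* The coefficient of the [k]-th element of the basis (1, omega, theta) in the
   product of the [i]-th and the [j]-th one. *)
Definition cubic_cst (K : comNzRingType) (f : cubic_form K) (i j k : nat) : K :=
  let: CubicForm a b c d := f in
  nth 0 (nth [::] (nth [::]
    [:: [:: [:: 1; 0; 0]; [:: 0; 1; 0]              ; [:: 0; 0; 1]             ];
        [:: [:: 0; 1; 0]; [:: - (a * c); - b; a]    ; [:: - (a * d); 0; 0]     ];
        [:: [:: 0; 0; 1]; [:: - (a * d); 0; 0]      ; [:: - (b * d); - d; c]   ]
    ] i) j) k.

(* [cubic_alg f D] is the K-algebra [D (x)_K T_f], where [T_f] is the based
   cubic ring of [f]; [x] stands for
   [x 0 0 (x) 1 + x 0 1 (x) omega + x 0 2 (x) theta]. In particular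
   [cubic_alg f K^o] is [T_f] itself. *)
Definition cubic_alg (K : comNzRingType) (f : cubic_form K) (D : algType K) :
  Type := 'rV[D]_3.

Section CubicAlgebra.
Variables (K : comNzRingType) (f : cubic_form K) (D : algType K).
Local Notation E := (cubic_alg f D).

HB.instance Definition _ := GRing.Zmodule.on E.

Definition cf (x : E) (k : 'I_3) : D := (x : 'rV[D]_3) 0 k.
Definition mkE (g : 'I_3 -> D) : E := (\row_k g k : 'rV[D]_3).

Lemma cfE g k : cf (mkE g) k = g k. Proof. by rewrite /cf mxE. Qed.
Lemma cfP (x y : E) : cf x =1 cf y -> x = y.
Proof. by move=> h; apply/rowP. Qed.
Lemma cfD (x y : E) k : cf (x + y) k = cf x k + cf y k.
Proof. by rewrite /cf mxE. Qed.
Lemma cf0 k : cf 0 k = 0. Proof. by rewrite /cf mxE. Qed.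

Definition cubic_one : E := mkE (fun k => (k == 0)%:R).
Definition cubic_mul (x y : E) : E :=
  mkE (fun k => \sum_(i < 3) \sum_(j < 3) cubic_cst f i j k *: (cf x i * cf y j)).
Definition cubic_scale (r : K) (x : E) : E := mkE (fun k => r *: cf x k).

Lemma cubic_cst_assoc (i j m k : 'I_3) :
  \sum_(l < 3) cubic_cst f l m k * cubic_cst f i j l =
  \sum_(l < 3) cubic_cst f i l k * cubic_cst f j m l.
Proof.
case: f => a b c d; rewrite !big_ord_recl !big_ord0.
case: i => -[|[|[|//]]] /= _; case: j => -[|[|[|//]]] /= _;
case: m => -[|[|[|//]]] /= _; case: k => -[|[|[|//]]] /= _ ; ring.
Qed.

Fact cubic_mulA : associative cubic_mul.
Proof.
move=> x y z; apply: cfP => k; rewrite !cfE.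
pose G (c : 'I_3 -> 'I_3 -> 'I_3 -> K) := \sum_i \sum_j \sum_m
  c i j m *: (cf x i * cf y j * cf z m).
transitivity (G (fun i j m => \sum_(l < 3) cubic_cst f i l k * cubic_cst f j m l)).
  apply: eq_bigr => i _.
  under eq_bigr => l _ do rewrite cfE mulr_sumr scaler_sumr.
  rewrite exchange_big; apply: eq_bigr => j _.
  under eq_bigr => l _ do rewrite mulr_sumr scaler_sumr.
  rewrite exchange_big; apply: eq_bigr => m _.
  rewrite scaler_suml; apply: eq_bigr => l _.
  by rewrite -scalerAr scalerA mulrA.
transitivity (G (fun i j m => \sum_(l < 3) cubic_cst f l m k * cubic_cst f i j l)).
  by rewrite /G; do 3!(apply: eq_bigr => ? _); rewrite cubic_cst_assoc.
symmetry; rewrite exchange_big /=.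
under eq_bigr => m _.
  under eq_bigr => l _.
    rewrite cfE mulr_suml scaler_sumr.
    under eq_bigr => i _ do rewrite mulr_suml scaler_sumr.
    over.
  over.
transitivity (\sum_(m < 3) \sum_(i < 3) \sum_(j < 3) \sum_(l < 3)
    (cubic_cst f l m k * cubic_cst f i j l) *: (cf x i * cf y j * cf z m)).
  apply: eq_bigr => m _; rewrite exchange_big; apply: eq_bigr => i _.
  rewrite exchange_big; apply: eq_bigr => j _; apply: eq_bigr => l _.
  by rewrite -scalerAl scalerA.
rewrite exchange_big; apply: eq_bigr => i _.
rewrite exchange_big; apply: eq_bigr => j _; apply: eq_bigr => m _.
by rewrite scaler_suml.
Qed.

Fact cubic_mul1x : left_id cubic_one cubic_mul.
Proof.
move=> x; apply: cfP => k; rewrite !cfE !big_ord_recl !big_ord0 !cfE /=.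
rewrite !mul0r !scaler0 !addr0 !mul1r /cubic_cst; case: f => a b c d /=.
case: k => -[|[|[|//]]] kP /=;
  rewrite !(scale0r, scale1r, addr0, add0r); congr (cf x _); exact: val_inj.
Qed.

Fact cubic_mulx1 : right_id cubic_one cubic_mul.
Proof.
move=> x; apply: cfP => k; rewrite !cfE !big_ord_recl !big_ord0 !cfE /=.
rewrite !mulr0 !scaler0 !addr0 !mulr1 /cubic_cst; case: f => a b c d /=.
case: k => -[|[|[|//]]] kP /=;
  rewrite !(scale0r, scale1r, addr0, add0r); congr (cf x _); exact: val_inj.
Qed.

Fact cubic_mulDl : left_distributive cubic_mul +%R.
Proof.
move=> x y z; apply: cfP => k; rewrite cfD !cfE -big_split.
apply: eq_bigr => i _; rewrite -big_split; apply: eq_bigr => j _.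
by rewrite cfD mulrDl scalerDr.
Qed.

Fact cubic_mulDr : right_distributive cubic_mul +%R.
Proof.
move=> x y z; apply: cfP => k; rewrite cfD !cfE -big_split.
apply: eq_bigr => i _; rewrite -big_split; apply: eq_bigr => j _.
by rewrite cfD mulrDr scalerDr.
Qed.

Fact cubic_1neq0 : cubic_one != 0.
Proof.
apply/eqP => /(congr1 (fun x => cf x 0)); rewrite cfE cf0 /=.
by apply/eqP; rewrite oner_eq0.
Qed.

HB.instance Definition _ := GRing.Zmodule_isNzRing.Build E
  cubic_mulA cubic_mul1x cubic_mulx1 cubic_mulDl cubic_mulDr cubic_1neq0.

Fact cubic_scaleA a b (x : E) :
  cubic_scale a (cubic_scale b x) = cubic_scale (a * b) x.
Proof. by apply: cfP => k; rewrite !cfE scalerA. Qed.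
Fact cubic_scale1 : left_id 1 cubic_scale.
Proof. by move=> x; apply: cfP => k; rewrite cfE scale1r. Qed.
Fact cubic_scaleDr : right_distributive cubic_scale +%R.
Proof. by move=> r x y; apply: cfP => k; rewrite cfD !cfE cfD scalerDr. Qed.
Fact cubic_scaleDl (x : E) : {morph cubic_scale^~ x : a b / a + b}.
Proof. by move=> a b; apply: cfP => k; rewrite cfD !cfE scalerDl. Qed.

HB.instance Definition _ := GRing.Zmodule_isLmodule.Build K E
  cubic_scaleA cubic_scale1 cubic_scaleDr cubic_scaleDl.

Fact cubic_scaleAl r (x y : E) : r *: (x * y) = (r *: x) * y.
Proof.
apply: cfP => k; rewrite !cfE scaler_sumr; apply: eq_bigr => i _.
rewrite scaler_sumr; apply: eq_bigr => j _.
by rewrite cfE -scalerAl !scalerA mulrC.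
Qed.

HB.instance Definition _ := GRing.Lmodule_isLalgebra.Build K E cubic_scaleAl.

Fact cubic_scaleAr r (x y : E) : r *: (x * y) = x * (r *: y).
Proof.
apply: cfP => k; rewrite !cfE scaler_sumr; apply: eq_bigr => i _.
rewrite scaler_sumr; apply: eq_bigr => j _.
by rewrite cfE -scalerAr !scalerA mulrC.
Qed.

HB.instance Definition _ := GRing.Lalgebra_isAlgebra.Build K E cubic_scaleAr.

End CubicAlgebra.

(* Base change of coefficients, for [D -> D'] over [K -> K']. *)
Definition map_cubic (K K' : comNzRingType) (g : K -> K') (f : cubic_form K)
    (D : algType K) (D' : algType K') (h : D -> D') (x : cubic_alg f D) :
    cubic_alg (map_form g f) D' := mkE _ (fun k => h (cf x k)).

Section CubicRing.
Variables (K : comNzRingType) (f : cubic_form K).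
Local Notation T := (cubic_alg f K^o).

Definition tbasis (i : 'I_3) : T := mkE f (fun k => (k == i)%:R : K^o).
Definition omega : T := tbasis 1.
Definition theta : T := tbasis 2.

Lemma omega_theta : omega * theta = (- (fa f * fd f))%:A.
Proof.
apply: cfP => k; rewrite !cfE !big_ord_recl !big_ord0 !cfE /=.
case: f => a b c d /=; case: k => -[|[|[|//]]] kP /=;
  rewrite !(scale0r, addr0, add0r, mulr0, mul0r, mulr1, scaler0) //=.
Qed.

Lemma omega_sqr :
  omega ^+ 2 = - (fa f * fc f)%:A + fa f *: theta - fb f *: omega.
Proof.
apply: cfP => k; rewrite -!scaleNr expr2 !cfD !cfE.
rewrite !big_ord_recl !big_ord0 !cfE /=.
case: f => a b c d /=; case: k => -[|[|[|//]]] kP /=;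
  rewrite !(scale0r, addr0, add0r, mulr0, mul0r, mulr1, scaler0) //=.
Qed.

Lemma theta_sqr :
  theta ^+ 2 = - (fb f * fd f)%:A + fc f *: theta - fd f *: omega.
Proof.
apply: cfP => k; rewrite -!scaleNr expr2 !cfD !cfE.
rewrite !big_ord_recl !big_ord0 !cfE /=.
case: f => a b c d /=; case: k => -[|[|[|//]]] kP /=;
  rewrite !(scale0r, addr0, add0r, mulr0, mul0r, mulr1, scaler0) //=.
Qed.

(* The matrix of multiplication by [x] in the basis (1, omega, theta). *)
Definition tmul_mx (x : T) : 'M[K]_3 :=
  \matrix_(i < 3, j < 3) cf (tbasis i * x) j.

Definition ttrace (x : T) : K := \tr (tmul_mx x).

(* The characteristic polynomial is X^3 - t1 X^2 + t2 X - t3. *)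
Definition t1 (x : T) : K := - (char_poly (tmul_mx x))`_2.
Definition t2 (x : T) : K := (char_poly (tmul_mx x))`_1.

Definition tadj (x : T) : T := x ^+ 2 - t1 x *: x + (t2 x)%:A.
Definition tcross (x y : T) : T := tadj (x + y) - tadj x - tadj y.

Variable D : algType K.

(* Pure tensors in [M_{m,n}(D) (x) T = M_{m,n}(D (x) T)]. *)
Definition tens (m n : nat) (U : 'M[D]_(m, n)) (x : T) :
    'M[cubic_alg f D]_(m, n) :=
  map_mx (fun u : D => mkE f (fun k => (cf x k : K) *: u)) U.

(* The matrices with [Z = sum_i tens (mcf Z i) (tbasis i)]. *)
Definition mcf (m n : nat) (Z : 'M[cubic_alg f D]_(m, n)) (i : 'I_3) :
    'M[D]_(m, n) := map_mx (fun z : cubic_alg f D => cf z i) Z.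

End CubicRing.

Section Forms.
Variables (R : idomainType) (C : comp_algebra R) (A B : 'M[C]_3).

Definition form_AB : cubic_form R :=
  CubicForm (normH A) (pairH (adjH A) B) (pairH A (adjH B)) (normH B).
Definition form_ABF : cubic_form {fraction R} := map_form (@tofrac R) form_AB.

End Forms.

(* The ring T, the algebra L = T (x)_R F, and the algebras C (x)_R T and
   C (x)_R L = C_F (x)_F L. *)
Notation ring_T A B := (@cubic_alg _ (form_AB A B) (_ : idomainType)^o).
Notation alg_L A B := (cubic_alg (form_ABF A B) {fraction _}^o).
Notation C_T C A B := (cubic_alg (@form_AB _ C A B) C).
Notation C_L C A B := (cubic_alg (@form_ABF _ C A B) (ca_frac C)).

Section Pair.
Variables (R : idomainType) (C : comp_algebra R) (A B : 'M[C]_3).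
Local Notation F := {fraction R}.
Local Notation fAB := (form_AB A B).
Local Notation fABF := (form_ABF A B).
Local Notation T := (ring_T A B).
Local Notation L := (alg_L A B).
Local Notation CT := (C_T C A B).
Local Notation CL := (C_L C A B).

Definition T_to_L : T -> L :=
  @map_cubic R F (@tofrac R) fAB R^o F^o (@tofrac R).
Definition CT_to_CL : CT -> CL :=
  @map_cubic R F (@tofrac R) fAB C (ca_frac C) (@ca_map R C).

(* [(U1 (x) l1) *_T (U2 (x) l2) = (U1 * U2) (x) (l1 * l2)], bilinearly
   extended through the decomposition of J (x) T along (1, omega, theta). *)
Definition crossT (Z Z' : 'M[CT]_3) : 'M[CT]_3 :=
  \sum_(i < 3) \sum_(j < 3)
    tens (crossH (mcf Z i) (mcf Z' j))
         (tcross (tbasis fAB i) (tbasis fAB j)).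

Definition elt_X : 'M[CT]_3 :=
  - tens A (theta fAB) + tens B (omega fAB)
  + tens (crossH (adjH A) (adjH B)) (1 : T).

Definition elt_XL : 'M[CL]_3 := map_mx CT_to_CL elt_X.

(* Y lies in J (x) T, but the division by 2 is carried out over F. *)
Definition elt_YL : 'M[CL]_3 :=
  ((2%:R : F)^-1)%:A *: map_mx CT_to_CL (crossT elt_X elt_X).

Definition S_r (t : T) : 'M[C]_3 :=
  (cf t 0 : R)%:A *: 1%:M
  + (cf t 1 : R)%:A *: (- (adjH A *m B))
  + (cf t 2 : R)%:A *: (adjH B *m A).

(* [v] is an R-basis of T and [w] is its dual basis for the trace form. *)
Definition dual_bases (v : 'I_3 -> T) (w : 'I_3 -> L) : Prop :=
  free_basis v /\
  forall i j, ttrace (T_to_L (v i) * w j) = (i == j)%:R.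

Definition epsilon (v : 'I_3 -> T) (w : 'I_3 -> L) : 'M[CL]_3 :=
  \sum_(i < 3) tens (map_mx (@ca_map R C) (S_r (v i))) (w i).

(* [u], seen in C_L^3. *)
Definition row_L (u : 'rV[C]_3) : 'rV[CL]_3 :=
  tens (map_mx (@ca_map R C) u) (1 : L).

(* The L-linear extension of the involution to C_L. *)
Definition star_L (z : CL) : CL := mkE _ (fun k => ca_starF (cf z k)).

End Pair.

(* Main.v *)
(* Put S(omega) = - A^# B, S(theta) = B^# A and N = Y X. A computation in the
   cubic ring expresses N as a combination of 1, S(omega) and S(theta) whose
   coefficients are Q times the basis of L dual to (1, omega, theta); hence
   N = Q epsilon. Similarly Y X Y = Q Y. Moreover X is of rank one, X^# = 0,
   whence X h X = (X, h) X for every Hermitian h, and so X u^* u X = (u X u^* ) X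
   for every row vector u. With u = v Y this gives
   Q^2 (v epsilon)^* (v epsilon) = X Y v^* v Y X = (v Y X Y v^* ) X
   = Q (v Y v^* ) X, and Q cancels. All these computations rest on the identity
   x^# * h = (x, h) x - x h x of the cubic Jordan algebra H_3(C), which follows
   from x^# = x^2 - t x + s and from the polarization of x^# x = n(x). *)
Require Import Defs.
From HB Require Import structures.
From mathcomp Require Import all_boot all_order all_algebra all_field.
From mathcomp Require Import ring.

Set Implicit Arguments.
Unset Strict Implicit.
Unset Printing Implicit Defensive.

Import GRing.Theory.
Local Open Scope ring_scope.

(** * Case analysis over three indices, and linear combinations of equations *)

Lemma ord3P (P : 'I_3 -> Prop) : P 0 -> P 1 -> P 2 -> forall i, P i.
Proof.
move=> P0 P1 P2; case=> -[|[|[|//]]] iP.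
- by rewrite (_ : Ordinal iP = 0) //; apply: val_inj.
- by rewrite (_ : Ordinal iP = 1) //; apply: val_inj.
- by rewrite (_ : Ordinal iP = 2) //; apply: val_inj.
Qed.

Lemma sum3 (V : nmodType) (f : 'I_3 -> V) : \sum_i f i = f 0 + f 1 + f 2.
Proof.
rewrite !big_ord_recl big_ord0 addr0 addrA; congr (_ + f _ + f _); exact: val_inj.
Qed.

(** A certificate for linear elimination: [p] and [q] are the multipliers of two known equations,
    and [ring] checks the last premise. *)
Lemma eq_lincomb (K : pzRingType) (p q s1 t1 s2 t2 x y : K) : s1 = t1 -> s2 = t2 ->
  x - y = p * (s1 - t1) + q * (s2 - t2) -> x = y.
Proof. by move=> -> -> /eqP; rewrite !subrr !mulr0 addr0 subr_eq0 => /eqP. Qed.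

(** * Cubic rings and their base changes *)

Lemma det_mx33 (K : comNzRingType) (M : 'M[K]_3) :
  \det M = M 0 0 * (M 1 1 * M 2 2 - M 1 2 * M 2 1)
    - M 0 1 * (M 1 0 * M 2 2 - M 1 2 * M 2 0)
    + M 0 2 * (M 1 0 * M 2 1 - M 1 1 * M 2 0).
Proof.
(* With indices in [nat], the lifted ordinals of the nested cofactor expansions compute to literals,
   so [ring] sees equal atoms. *)
pose g (i j : nat) := M (inord i) (inord j).
have gE i j : M i j = g i j by rewrite /g !inord_val.
rewrite (expand_det_row _ ord0) !big_ord_recl big_ord0 /cofactor.
rewrite !(expand_det_row _ ord0) !big_ord_recl !big_ord0 /cofactor !det_mx11.
by rewrite !mxE !gE /= /bump /=; ring.
Qed.

Lemma char_poly3 (K : comNzRingType) (M : 'M[K]_3) :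
  ((char_poly M)`_2 = - (M 0 0 + M 1 1 + M 2 2)) *
  ((char_poly M)`_1 = M 0 0 * M 1 1 - M 0 1 * M 1 0 + (M 0 0 * M 2 2 - M 0 2 * M 2 0)
    + (M 1 1 * M 2 2 - M 1 2 * M 2 1)).
Proof.
have -> : char_poly M = 'X^3 - (M 0 0 + M 1 1 + M 2 2)%:P * 'X^2
    + (M 0 0 * M 1 1 - M 0 1 * M 1 0 + (M 0 0 * M 2 2 - M 0 2 * M 2 0)
    + (M 1 1 * M 2 2 - M 1 2 * M 2 1))%:P * 'X - (\det M)%:P.
  rewrite /char_poly !det_mx33 !mxE /= ?mulr1n ?mulr0n.
  by rewrite !(polyCD, polyCB, polyCN, polyCM); ring.
by rewrite !(coefB, coefD, coefCM, coefXn, coefX, coefC) /=; split; ring.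
Qed.

(* [disc f] times the inverse of the Gram matrix of the trace form. *)
Definition dual_cst (K : comNzRingType) (f : cubic_form K) (i j : 'I_3) : K :=
  let: CubicForm a b c d := f in
  nth 0 (nth [::]
    [:: [:: b ^+ 2 * c ^+ 2 - 2%:R * a * c ^+ 3 - 2%:R * b ^+ 3 * d
              + 4%:R * a * b * c * d - 9%:R * a ^+ 2 * d ^+ 2;
            b * c ^+ 2 - 3%:R * a * c * d - 2%:R * b ^+ 2 * d;
            2%:R * a * c ^+ 2 - b ^+ 2 * c + 3%:R * a * b * d];
        [:: b * c ^+ 2 - 3%:R * a * c * d - 2%:R * b ^+ 2 * d;
            2%:R * c ^+ 2 - 6%:R * b * d; 9%:R * a * d - b * c];
        [:: 2%:R * a * c ^+ 2 - b ^+ 2 * c + 3%:R * a * b * d;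
            9%:R * a * d - b * c; 2%:R * b ^+ 2 - 6%:R * a * c] ] i) j.

Section CubicAlgebraTheory.
Variables (K : comNzRingType) (f : cubic_form K).
Local Notation T := (cubic_alg f K^o).

Section Components.
Variable D : algType K.
Local Notation E := (cubic_alg f D).

Lemma mcfP m n (Z Z' : 'M[E]_(m, n)) : mcf Z =1 mcf Z' -> Z = Z'.
Proof.
move=> ZZ; apply/matrixP => i j; apply: cfP => k.
by have /matrixP/(_ i j) := ZZ k; rewrite !mxE.
Qed.

Lemma cf_sum I r (P : pred I) (F : I -> E) k :
  cf (\sum_(i <- r | P i) F i) k = \sum_(i <- r | P i) cf (F i) k.
Proof.
exact: (big_morph (fun x : E => cf x k) (fun x y => cfD x y k) (cf0 f D k)).
Qed.

Lemma cfZ r (x : E) k : cf (r *: x) k = r *: cf x k.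
Proof. exact: cfE. Qed.

Lemma mcfD m n (Z Z' : 'M[E]_(m, n)) k : mcf (Z + Z') k = mcf Z k + mcf Z' k.
Proof. by apply/matrixP => i j; rewrite !mxE cfD. Qed.

Lemma mcf0 m n k : mcf (0 : 'M[E]_(m, n)) k = 0.
Proof. by apply/matrixP => i j; rewrite !mxE cf0. Qed.

Lemma mcfN m n (Z : 'M[E]_(m, n)) k : mcf (- Z) k = - mcf Z k.
Proof. by apply/eqP; rewrite -addr_eq0 -mcfD addNr mcf0. Qed.

Lemma mcf_sum m n I r (P : pred I) (F : I -> 'M[E]_(m, n)) k :
  mcf (\sum_(i <- r | P i) F i) k = \sum_(i <- r | P i) mcf (F i) k.
Proof.
exact: (big_morph (fun Z : 'M[E]_(m, n) => mcf Z k)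
          (fun Z Z' => mcfD Z Z' k) (mcf0 m n k)).
Qed.

(** Here and below scalars appear as [r%:A : D], since matrices over [D] form a left module over
    [D], not directly over [K]. *)
Lemma mcf_tens m n (U : 'M[D]_(m, n)) (x : T) k :
  mcf (tens U x) k = ((cf x k : K)%:A : D) *: U.
Proof. by apply/matrixP => i j; rewrite !mxE !cfE -scalerAl mul1r. Qed.

Lemma mcfM m n p (Z : 'M[E]_(m, n)) (Z' : 'M[E]_(n, p)) k :
  mcf (Z *m Z') k = \sum_(i < 3) \sum_(j < 3)
    ((cubic_cst f i j k)%:A : D) *: (mcf Z i *m mcf Z' j).
Proof.
apply/matrixP => r s; rewrite !mxE cf_sum summxE.
under eq_bigr => t _ do rewrite cfE.
rewrite exchange_big; apply: eq_bigr => i _; rewrite summxE exchange_big.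
apply: eq_bigr => j _; rewrite !mxE mulr_sumr; apply: eq_bigr => t _.
by rewrite !mxE -scalerAl mul1r.
Qed.

Lemma mcf_scale m n (z : E) (Z : 'M[E]_(m, n)) k : mcf (z *: Z) k =
  \sum_(i < 3) \sum_(j < 3) ((cubic_cst f i j k)%:A : D) *: (cf z i *: mcf Z j).
Proof.
apply/matrixP => r s; rewrite !mxE cfE summxE; apply: eq_bigr => i _.
by rewrite summxE; apply: eq_bigr => j _; rewrite !mxE -scalerAl mul1r.
Qed.

Lemma mcf_scaleA m n (r : K) (Z : 'M[E]_(m, n)) k :
  mcf ((r%:A : E) *: Z) k = (r%:A : D) *: mcf Z k.
Proof.
by apply/matrixP => i j; rewrite !mxE -!scalerAl !mul1r cfZ.
Qed.

Lemma cubic_cst0 (i j : 'I_3) :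
  ((cubic_cst f 0 i j = (i == j)%:R) * (cubic_cst f i 0 j = (i == j)%:R)).
Proof. by case: f; elim/ord3P: i; elim/ord3P: j. Qed.

Lemma cubic_cstC (i j k : 'I_3) : cubic_cst f i j k = cubic_cst f j i k.
Proof. by case: f; elim/ord3P: i; elim/ord3P: j. Qed.

Lemma mcf_mul_tens1 m n p (Z : 'M[E]_(m, n)) (U : 'M[D]_(n, p)) k :
  mcf (Z *m tens U (1 : T)) k = mcf Z k *m U.
Proof.
rewrite mcfM; under eq_bigr => i _.
  rewrite (bigD1 0) // big1 /= => [|j /negPf j0].
    rewrite mcf_tens cfE eqxx !scale1r (cubic_cst0 i k).2. over.
  by rewrite mcf_tens cfE j0 !scale0r mulmx0 scaler0.
rewrite (bigD1 k) // big1 /= => [|i /negPf ik].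
  by rewrite !addr0 eqxx !scale1r.
by rewrite ik !scale0r addr0.
Qed.

Lemma mcf_tens1_mul m n p (Z : 'M[E]_(n, p)) (U : 'M[D]_(m, n)) k :
  mcf (tens U (1 : T) *m Z) k = U *m mcf Z k.
Proof.
rewrite mcfM exchange_big; under eq_bigr => i _.
  rewrite (bigD1 0) // big1 /= => [|j /negPf j0].
    rewrite mcf_tens cfE eqxx !scale1r (cubic_cst0 i k).1. over.
  by rewrite mcf_tens cfE j0 !scale0r mul0mx scaler0.
rewrite (bigD1 k) // big1 /= => [|i /negPf ik].
  by rewrite !addr0 eqxx !scale1r.
by rewrite ik !scale0r addr0.
Qed.

End Components.

Lemma ttraceE (x : T) : ttrace x = \sum_(l < 3) cf (tbasis f l * x) l.
Proof. by apply: eq_bigr => l _; rewrite !mxE. Qed.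

Lemma ttraceD (x y : T) : ttrace (x + y) = ttrace x + ttrace y.
Proof.
by rewrite !ttraceE -big_split; apply: eq_bigr => l _; rewrite mulrDr cfD.
Qed.

Lemma ttraceZ (r : K) (x : T) : ttrace (r *: x) = r * ttrace x.
Proof.
by rewrite !ttraceE mulr_sumr; apply: eq_bigr => l _; rewrite -scalerAr cfZ.
Qed.

Lemma cf_tbasis i j : cf (tbasis f i) j = (j == i)%:R.
Proof. by rewrite cfE. Qed.

Lemma cf_mul (x y : T) k : cf (x * y) k = \sum_(i < 3) \sum_(j < 3)
  cubic_cst f i j k * ((cf x i : K) * (cf y j : K)) :> K.
Proof. by rewrite [LHS]cfE. Qed.

Lemma t1E (x : T) : t1 x =
  3%:R * (cf x 0 : K) - fb f * (cf x 1 : K) + fc f * (cf x 2 : K).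
Proof.
rewrite /t1 char_poly3 /tmul_mx !mxE !cf_mul !sum3 !cf_tbasis.
case: f x => a b c d x /=; ring.
Qed.

Lemma t2E (x : T) (x0 := cf x 0 : K) (x1 := cf x 1 : K) (x2 := cf x 2 : K) :
  t2 x = 3%:R * x0 ^+ 2 - 2%:R * fb f * x0 * x1 + 2%:R * fc f * x0 * x2
    + fa f * fc f * x1 ^+ 2 + fb f * fd f * x2 ^+ 2
    + (3%:R * fa f * fd f - fb f * fc f) * x1 * x2.
Proof.
rewrite /t2 char_poly3 /tmul_mx !mxE !cf_mul !sum3 !cf_tbasis {}/x0 {}/x1 {}/x2.
case: f x => a b c d x /=; ring.
Qed.

Lemma cf_tadj (x : T) k : cf (tadj x) k =
  (\sum_(i < 3) \sum_(j < 3) cubic_cst f i j k * ((cf x i : K) * (cf x j : K)))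
  - t1 x * cf x k + t2 x * (k == 0)%:R :> K.
Proof.
rewrite /tadj !cfD expr2 cf_mul; congr (_ + _ + _).
- by rewrite -scaleNr cfZ -mulNr.
- by rewrite cfZ cfE.
Qed.

(** Structure constants of the cross product of T on (1, omega, theta); the diagonal encodes omega^#
    = a theta and theta^# = - d omega. *)
Definition tcross_cst (i j k : nat) : K :=
  let: CubicForm a b c d := f in
  nth 0 (nth [::] (nth [::]
    [:: [:: [:: 2%:R; 0; 0]; [:: - b; - 1; 0]; [:: c; 0; - 1]];
        [:: [:: - b; - 1; 0]; [:: 0; 0; 2%:R * a]; [:: a * d - b * c; - c; b]];
        [:: [:: c; 0; - 1]; [:: a * d - b * c; - c; b]; [:: 0; - (2%:R * d); 0]]
    ] i) j) k.

Lemma cf_tcrossE (x y : T) k : cf (tcross x y) k =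
  (\sum_(i < 3) \sum_(j < 3) cubic_cst f i j k *
     ((cf x i : K) * (cf y j : K) + (cf y i : K) * (cf x j : K)))
  - t1 x * cf y k - t1 y * cf x k
  + (t2 (x + y) - t2 x - t2 y) * (k == 0)%:R :> K.
Proof.
have t1D : t1 (x + y) = t1 x + t1 y by rewrite !t1E !cfD; ring.
have cfN (z : T) : cf (- z) k = - cf z k by rewrite -!scaleN1r cfZ.
rewrite /tcross cfD cfN cfD cfN !cf_tadj t1D !sum3 !(cfD x y).
move: (t1 x) (t1 y) (t2 (x + y)) (t2 x) (t2 y) (cubic_cst f) => s t u v w g.
move: (cf x) (cf y) => x' y'; ring.
Qed.

Lemma cf_tcross (i j k : 'I_3) :
  cf (tcross (tbasis f i) (tbasis f j)) k = tcross_cst i j k.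
Proof.
rewrite cf_tcrossE !t1E !t2E !cfD !cf_tbasis !sum3 !cf_tbasis.
rewrite /tcross_cst; case: f => a b c d.
by elim/ord3P: i; elim/ord3P: j; elim/ord3P: k => /=; ring.
Qed.

Lemma ttrace_cf (x : T) : ttrace x =
  3%:R * (cf x 0 : K) - fb f * (cf x 1 : K) + fc f * (cf x 2 : K).
Proof. by rewrite -t1E /t1 char_poly_trace ?opprK. Qed.

(** Pairing [x] with the basis applies the Gram matrix of the trace form to its coordinates, and
    [dual_cst] inverts that matrix up to the factor Q. This form avoids division. *)
Lemma disc_cf (x : T) k : disc f * cf x k =
  \sum_(l < 3) dual_cst f k l * ttrace (tbasis f l * x) :> K.
Proof.
rewrite sum3 !ttrace_cf !cf_mul !sum3 !cf_tbasis; case: f x => a b c d x.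
by elim/ord3P: k => /=; ring.
Qed.

Let ttrace0 : ttrace (0 : T) = 0.
Proof. by have := ttraceZ 0 (0 : T); rewrite scale0r mul0r. Qed.

Lemma ttrace_sumr (x : T) (r : 'I_3 -> K) (y : 'I_3 -> T) :
  ttrace (x * (\sum_i r i *: y i)) = \sum_i r i * ttrace (x * y i).
Proof.
rewrite mulr_sumr (big_morph (@ttrace K f) ttraceD ttrace0).
by apply: eq_bigr => i _; rewrite -scalerAr ttraceZ.
Qed.

Lemma ttrace_suml (x : T) (r : 'I_3 -> K) (y : 'I_3 -> T) :
  ttrace ((\sum_i r i *: y i) * x) = \sum_i r i * ttrace (y i * x).
Proof.
rewrite mulr_suml (big_morph (@ttrace K f) ttraceD ttrace0).
by apply: eq_bigr => i _; rewrite -scalerAl ttraceZ.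
Qed.

Lemma cf_lin_sum (r : 'I_3 -> K) (y : 'I_3 -> T) k :
  cf (\sum_i r i *: y i) k = \sum_i r i * (cf (y i) k : K) :> K.
Proof. by rewrite cf_sum; apply: eq_bigr => i _; rewrite cfZ. Qed.

End CubicAlgebraTheory.

Lemma cubic_cst_map (K K' : comNzRingType) (g : {rmorphism K -> K'})
    (f : cubic_form K) (i j k : 'I_3) :
  cubic_cst (map_form g f) i j k = g (cubic_cst f i j k).
Proof.
case: f => p q r s; elim/ord3P: i; elim/ord3P: j; elim/ord3P: k => /=;
  by rewrite ?(rmorph0, rmorph1, rmorphN, rmorphM).
Qed.

Lemma dual_cst_map (K K' : comNzRingType) (g : {rmorphism K -> K'})
    (f : cubic_form K) (i j : 'I_3) :
  dual_cst (map_form g f) i j = g (dual_cst f i j).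
Proof. by case: f => p q r s; elim/ord3P: i; elim/ord3P: j => /=; ring. Qed.

Lemma disc_map (K K' : comNzRingType) (g : {rmorphism K -> K'}) (f : cubic_form K) :
  disc (map_form g f) = g (disc f).
Proof. by case: f => p q r s /=; ring. Qed.

Lemma scalarA_mul3 (K : comNzRingType) (D : algType K) (p q r : K) (x : D) :
  p%:A * (q%:A * (r%:A * x)) = (p * (r * q))%:A * x.
Proof. by rewrite -!scalerAl !mul1r !scalerA mulrAC mulrA. Qed.

(** Left scaling moves past [U] because [r%:A] is central in [D]. *)
Lemma mulmx_scaleA (K : comNzRingType) (D : algType K) m n p (r : K)
    (U : 'M[D]_(m, n)) (V : 'M[D]_(n, p)) :
  U *m ((r%:A : D) *: V) = (r%:A : D) *: (U *m V).
Proof.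
apply/matrixP => i j; rewrite !mxE mulr_sumr; apply: eq_bigr => k _.
by rewrite mxE -!scalerAl -scalerAr !mul1r.
Qed.

(** * The cubic Jordan algebra of Hermitian matrices *)

Section HermitianIdentities.
Variables (R : idomainType) (C : comp_algebra R).
Local Notation F := {fraction R}.
Local Notation "x ^*" := (ca_star x) : ring_scope.
Local Notation "r ** U" := ((r%:A : C) *: (U : 'M[C]_3))
  (at level 40, left associativity) : ring_scope.
Hypothesis charF : [pchar F] =i pred0.

(* Linear functionals reduce identities between linear combinations of words in
   the noncommutative algebras C and M_3(C) to the tactic [ring] over F. *)
Lemma ca_functionals (x y : C) :
  (forall g : {additive C -> F},
     (forall (r : R) z, g (r *: z) = tofrac r * g z) -> g x = g y) -> x = y.
Proof.
move=> gE; apply: ca_map_inj.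
rewrite (coord_vbasis (memvf (ca_map x))) (coord_vbasis (memvf (ca_map y))).
apply: eq_bigr => k _; congr (_ *: _).
pose g0 z := coord (vbasis {:ca_frac C}) k (ca_map z).
have g0B : zmod_morphism g0 by move=> u z; rewrite /g0 !raddfB.
pose g : {additive C -> F} := HB.pack g0 (GRing.isZmodMorphism.Build _ _ g0 g0B).
by apply: (gE g) => r z; rewrite /= /g0 ca_mapZ linearZ.
Qed.

Lemma mx3_functionals (U V : 'M[C]_3) :
  (forall g : {additive 'M[C]_3 -> F},
     (forall (r : R) W, g (r ** W) = tofrac r * g W) -> g U = g V) -> U = V.
Proof.
move=> gE; apply/matrixP => i j; apply: ca_functionals => g gZ.
pose g0 (W : 'M[C]_3) := g (W i j).
have g0B : zmod_morphism g0 by move=> u z; rewrite /g0 !mxE raddfB.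
pose g' : {additive 'M[C]_3 -> F} :=
  HB.pack g0 (GRing.isZmodMorphism.Build _ _ g0 g0B).
by apply: (gE g') => r W; rewrite /= /g0 mxE -scalerAl mul1r gZ.
Qed.

Lemma scalemx_mulr (r : R) (U V : 'M[C]_3) : U * (r ** V) = r ** (U * V).
Proof. exact: mulmx_scaleA. Qed.

Lemma scalemx_mull (r : R) (U V : 'M[C]_3) : (r ** U) * V = r ** (U * V).
Proof. by rewrite -scalerAl. Qed.

Lemma scalarA_inj : injective (fun r : R => r%:A : C).
Proof.
move=> r s /(congr1 (@ca_map R C)); rewrite !ca_mapA => /eqP.
rewrite -subr_eq0 -scalerBl scaler_eq0 oner_eq0 orbF subr_eq0.
by rewrite tofrac_eq => /eqP.
Qed.

Lemma scal_scalar (r : R) : scal (r%:A : C) = r.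
Proof. by apply: scalarA_inj; rewrite scalK //; exists r. Qed.

Lemma scalar3_inj : injective (fun r : R => r ** 1).
Proof.
move=> r s /matrixP/(_ 0 0); rewrite !mxE !mulr1; exact: scalarA_inj.
Qed.

(** Both sides must already be expanded into words: each [g word] is an atom for [ring], which does
    not multiply words. *)
Ltac by_functionals :=
  (apply: mx3_functionals || apply: ca_functionals);
  let g := fresh "g" in let gZ := fresh "gZ" in
  move=> g gZ;
  rewrite ?(raddfD g, raddfB g, raddfN g, raddfMn g, raddf0 g, gZ) /=;
  ring.

Definition ca_expand := (mulrDl, mulrDr, mulrBl, mulrBr, mulNr, mulrN).

(** * Norm and trace of C, and coordinates of Hermitian matrices *)

Lemma nCD (x y : C) : nC (x + y) = nC x + nC y + trC (x^* * y).
Proof.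
apply: scalarA_inj; rewrite /= !scalerDl trCE -!nCC ca_starD ca_starM ca_starK.
by rewrite !ca_expand; by_functionals.
Qed.

Lemma trCD (x y : C) : trC (x + y) = trC x + trC y.
Proof.
by apply: scalarA_inj; rewrite /= !scalerDl !trCE ca_starD; by_functionals.
Qed.

Lemma trCZ r (x : C) : trC (r *: x) = r * trC x.
Proof.
by apply: scalarA_inj; rewrite /= -scalerA !trCE ca_starZ scalerDr.
Qed.

Lemma trC_star (x : C) : trC x^* = trC x.
Proof. by apply: scalarA_inj; rewrite /= !trCE ca_starK addrC. Qed.

Lemma nCZ r (x : C) : nC (r *: x) = r ^+ 2 * nC x.
Proof.
apply: scalarA_inj; rewrite /= -scalerA !nCE ca_starZ -scalerAl -scalerAr.
by rewrite scalerA.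
Qed.

Lemma matrix3P (U V : 'M[C]_3) :
  U 0 0 = V 0 0 -> U 1 1 = V 1 1 -> U 2 2 = V 2 2 ->
  U 0 1 = V 0 1 -> U 0 2 = V 0 2 -> U 1 2 = V 1 2 ->
  U 1 0 = V 1 0 -> U 2 0 = V 2 0 -> U 2 1 = V 2 1 -> U = V.
Proof. by move=> *; apply/matrixP; do 2!elim/ord3P. Qed.

Lemma hermitianE (A : 'M[C]_3) i j : is_hermitian A -> A i j = (A j i)^*.
Proof. by move=> hA; rewrite -{1}hA !mxE. Qed.

Lemma hermitian_herm3 (A : 'M[C]_3) : is_hermitian A ->
  A = herm3 (hc1 A) (hc2 A) (hc3 A) (ha1 A) (ha2 A) (ha3 A).
Proof.
move=> hA; have dA i := scalK_diag charF i hA.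
by apply: matrix3P; rewrite !mxE /= ?dA // /ha1 /ha2 /ha3 -!(hermitianE _ _ hA).
Qed.

Lemma herm3_hermitian r1 r2 r3 (x1 x2 x3 : C) :
  is_hermitian (herm3 r1 r2 r3 x1 x2 x3).
Proof.
by apply: matrix3P; rewrite !mxE /= ?ca_starK ?ca_starZ ?ca_star1.
Qed.

Lemma herm3E r1 r2 r3 (x1 x2 x3 : C) (A := herm3 r1 r2 r3 x1 x2 x3) :
  ((hc1 A = r1) * (hc2 A = r2) * (hc3 A = r3)) *
  ((ha1 A = x1) * (ha2 A = x2) * (ha3 A = x3)).
Proof.
by rewrite /A /hc1 /hc2 /hc3 /ha1 /ha2 /ha3 !mxE /= !scal_scalar ca_starK.
Qed.

(** * Trace, quadratic trace and linearity of the coordinates *)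

Definition trace3 (A : 'M[C]_3) : R := hc1 A + hc2 A + hc3 A.
(** The middle coefficient s of the generic characteristic polynomial X^3 - t X^2 + s X - n; it is
    also the trace of A^#, see [trace3_adjH]. *)
Definition sigma2 (A : 'M[C]_3) : R :=
  hc2 A * hc3 A + hc3 A * hc1 A + hc1 A * hc2 A
  - (nC (ha1 A) + nC (ha2 A) + nC (ha3 A)).

(** Trades the entrywise formula for words in the associative algebra M_3(C). Entry by entry it only
    uses that x x^* and x^* x both equal the central element n(x). *)
Lemma adjH_sqr (A : 'M[C]_3) : is_hermitian A ->
  adjH A = A * A - trace3 A ** A + sigma2 A ** 1.
Proof.
move=> hA; rewrite [in RHS](hermitian_herm3 hA) /trace3 /sigma2 !herm3E /adjH.
move: (hc1 A) (hc2 A) (hc3 A) (ha1 A) (ha2 A) (ha3 A) => r1 r2 r3 x1 x2 x3.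
apply: matrix3P; rewrite !mxE sum3 !mxE /= ?mulr0 ?mulr1 -?scalerAl -?scalerAr
 ?mul1r ?mulr1 -?nCE ?nCC ?ca_starD -?scaleNr ?ca_starZ ?ca_starK ?ca_starM ?scalerA;
  by by_functionals.
Qed.

Section Linear.
Variables (A B : 'M[C]_3) (hA : is_hermitian A) (hB : is_hermitian B).

Lemma hermitianD : is_hermitian (A + B).
Proof.
by apply/matrixP => i j; rewrite !mxE ca_starD -!hermitianE.
Qed.

Lemma hermitianZ r : is_hermitian (r ** A).
Proof.
by apply/matrixP => i j; rewrite !mxE -!scalerAl !mul1r ca_starZ -hermitianE.
Qed.

Lemma adjH_hermitian : is_hermitian (adjH A).
Proof. exact: herm3_hermitian. Qed.

(** [scal] takes a default value outside R and is not additive on C; on Hermitian matrices the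
    diagonal entries are scalars by [scalK_diag]. *)
Lemma diagD i : scal ((A + B) i i) = scal (A i i) + scal (B i i).
Proof.
apply: scalarA_inj; rewrite /= scalerDl !(scalK_diag charF) ?mxE //.
exact: hermitianD.
Qed.

Lemma diagZ r i : scal ((r ** A) i i) = r * scal (A i i).
Proof.
apply: scalarA_inj; rewrite /= -scalerA !(scalK_diag charF) ?mxE //.
  by rewrite -scalerAl mul1r.
exact: hermitianZ.
Qed.

End Linear.

Lemma hcZ (A : 'M[C]_3) r : is_hermitian A ->
  (hc1 (r ** A) = r * hc1 A) * (hc2 (r ** A) = r * hc2 A)
  * (hc3 (r ** A) = r * hc3 A).
Proof. by move=> hA; rewrite /hc1 /hc2 /hc3 !diagZ. Qed.

Lemma haZ (A : 'M[C]_3) r :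
  (ha1 (r ** A) = r *: ha1 A) * (ha2 (r ** A) = r *: ha2 A)
  * (ha3 (r ** A) = r *: ha3 A).
Proof. by rewrite /ha1 /ha2 /ha3 !mxE -!scalerAl !mul1r ca_starZ. Qed.

Lemma haD (A B : 'M[C]_3) :
  (ha1 (A + B) = ha1 A + ha1 B) * (ha2 (A + B) = ha2 A + ha2 B)
  * (ha3 (A + B) = ha3 A + ha3 B).
Proof. by rewrite /ha1 /ha2 /ha3 !mxE ca_starD. Qed.

(** * Polarization of the trace pairing and of the cubic norm *)

Section Polar.
Implicit Types A B X Y Z : 'M[C]_3.

Lemma pairHC A B : pairH A B = pairH B A.
Proof.
have E (x y : C) : trC (x^* * y) = trC (y^* * x).
  by rewrite -trC_star ca_starM ca_starK.
by rewrite /pairH (E (ha1 A)) (E (ha2 A)) (E (ha3 A)); congr (_ + _); ring.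
Qed.

Lemma trC_mulD (x y z : C) :
  (trC ((x + y) * z) = trC (x * z) + trC (y * z)) *
  (trC (z * (x + y)) = trC (z * x) + trC (z * y)).
Proof. by rewrite mulrDl mulrDr !trCD. Qed.

Lemma pairHDl X Y Z : is_hermitian X -> is_hermitian Y ->
  pairH (X + Y) Z = pairH X Z + pairH Y Z.
Proof.
move=> hX hY; rewrite /pairH !haD /hc1 /hc2 /hc3 !(diagD hX hY) !ca_starD.
rewrite !trC_mulD; ring.
Qed.

Lemma pairHZl X Z r : is_hermitian X -> pairH (r ** X) Z = r * pairH X Z.
Proof.
move=> hX; rewrite /pairH !haZ !hcZ //.
rewrite !ca_starZ -!scalerAl !trCZ; ring.
Qed.

Lemma normHD A B : is_hermitian A -> is_hermitian B ->
  normH (A + B) = normH A + pairH (adjH A) B + pairH A (adjH B) + normH B.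
Proof.
move=> hA hB; rewrite (pairHC A) /normH /pairH /adjH !herm3E !haD /hc1 /hc2 /hc3.
rewrite !(diagD hA hB) -/(hc1 A) -/(hc1 B) -/(hc2 A) -/(hc2 B) -/(hc3 A) -/(hc3 B).
move: (hc1 A) (hc2 A) (hc3 A) (ha1 A) (ha2 A) (ha3 A) => r1 r2 r3 x1 x2 x3.
move: (hc1 B) (hc2 B) (hc3 B) (ha1 B) (ha2 B) (ha3 B) => s1 s2 s3 y1 y2 y3.
rewrite !nCD !ca_starD -!scaleNr !ca_starZ !ca_starK !mulrDl !mulrDr.
rewrite -!scalerAl !trCD !trCZ !mulrDl !trCD.
(* Cyclic invariance of the trace puts the words of length three into a common order; [E] below does
   the same for words of length two. *)
rewrite (trCC (x2 * x3)) (trCC (y2 * y3)) -!mulrA (trCC x3) (trCC y3) -!mulrA.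
have E (x y : C) : trC (x^* * y) = trC (y^* * x).
  by rewrite -trC_star ca_starM ca_starK.
by rewrite ?(E y1 x1) ?(E y2 x2) ?(E y3 x3); ring.
Qed.

End Polar.

(** * The cross product and the identities of the cubic Jordan algebra *)

Section Cross.
Implicit Types A B X Y Z U V : 'M[C]_3.

Lemma frac2_neq0 : (2%:R : F) != 0.
Proof. by rewrite ((pcharf0P _).1 charF). Qed.

Lemma mx3_mulr2_inj U V : U *+ 2 = V *+ 2 -> U = V.
Proof.
move=> E; apply: mx3_functionals => g _; apply: (mulIf frac2_neq0).
by rewrite !mulr_natr -!raddfMn E.
Qed.

Lemma hermitianN A : is_hermitian A -> is_hermitian (- A).
Proof. by move=> hA; rewrite -scaleN1r -[-1 : C]scaleN1r; apply: hermitianZ. Qed.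

Lemma scalemxN A : - A = (-1) ** A.
Proof. by rewrite !scaleN1r. Qed.

Lemma trace3D A B : is_hermitian A -> is_hermitian B ->
  trace3 (A + B) = trace3 A + trace3 B.
Proof. by move=> hA hB; rewrite /trace3 /hc1 /hc2 /hc3 !(diagD hA hB); ring. Qed.

Lemma trace3Z A r : is_hermitian A -> trace3 (r ** A) = r * trace3 A.
Proof. by move=> hA; rewrite /trace3 !hcZ //; ring. Qed.

Lemma sigma2D A B : is_hermitian A -> is_hermitian B ->
  sigma2 (A + B) = sigma2 A + sigma2 B + (trace3 A * trace3 B - pairH A B).
Proof.
move=> hA hB; rewrite /sigma2 /trace3 /pairH !haD !nCD /hc1 /hc2 /hc3.
by rewrite !(diagD hA hB); ring.
Qed.

Lemma sigma2Z A r : is_hermitian A -> sigma2 (r ** A) = r ^+ 2 * sigma2 A.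
Proof. by move=> hA; rewrite /sigma2 !haZ !hcZ // !nCZ; ring. Qed.

(* Locked, because unification would otherwise see a cross product as a sum
   and distribute over it. *)
Definition cross A B := locked (crossH A B).

Lemma cross_unlock A B : cross A B = crossH A B.
Proof. by rewrite /cross -lock. Qed.

(** Polarization of [adjH_sqr]; the polar form of s is t(A) t(B) - (A, B). *)
Lemma crossE A B : is_hermitian A -> is_hermitian B ->
  cross A B = A * B + B * A - trace3 A ** B - trace3 B ** A
    + (trace3 A * trace3 B - pairH A B) ** 1.
Proof.
move=> hA hB; rewrite cross_unlock /crossH !adjH_sqr ?sigma2D ?trace3D //;
  last exact: hermitianD.
rewrite !ca_expand; by_functionals.
Qed.

Lemma crossC A B : cross A B = cross B A.
Proof. by rewrite !cross_unlock /crossH [B + A]addrC addrAC. Qed.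

Lemma pairHDr Z A B : is_hermitian A -> is_hermitian B ->
  pairH Z (A + B) = pairH Z A + pairH Z B.
Proof. by move=> hA hB; rewrite !(pairHC Z) pairHDl. Qed.

Lemma pairHZr Z A r : is_hermitian A -> pairH Z (r ** A) = r * pairH Z A.
Proof. by move=> hA; rewrite !(pairHC Z) pairHZl. Qed.

Lemma adjHZ A r : is_hermitian A -> adjH (r ** A) = (r ^+ 2) ** adjH A.
Proof.
move=> hA; rewrite !adjH_sqr ?trace3Z ?sigma2Z //; last exact: hermitianZ.
rewrite scalemx_mull scalemx_mulr; by_functionals.
Qed.

Lemma crossZr A B r : is_hermitian A -> is_hermitian B ->
  cross A (r ** B) = r ** cross A B.
Proof.
move=> hA hB; rewrite !crossE ?trace3Z ?pairHZr //; last exact: hermitianZ.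
rewrite scalemx_mull scalemx_mulr; by_functionals.
Qed.

Lemma crossDr A B Z : is_hermitian A -> is_hermitian B -> is_hermitian Z ->
  cross A (B + Z) = cross A B + cross A Z.
Proof.
move=> hA hB hZ; rewrite !crossE ?trace3D ?pairHDr //; last exact: hermitianD.
rewrite !ca_expand; by_functionals.
Qed.

Lemma cross_diag A : is_hermitian A -> cross A A = adjH A *+ 2.
Proof.
move=> hA; rewrite cross_unlock /crossH (_ : A + A = 2%:R ** A);
  last by by_functionals.
by rewrite adjHZ //; by_functionals.
Qed.

Lemma cross_hermitian A B : is_hermitian A -> is_hermitian B ->
  is_hermitian (cross A B).
Proof.
move=> hA hB; rewrite cross_unlock; apply: hermitianD; first apply: hermitianD.
- exact: adjH_hermitian.
- by apply: hermitianN; apply: adjH_hermitian.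
- by apply: hermitianN; apply: adjH_hermitian.
Qed.

Lemma mul_adjH A : is_hermitian A -> A * adjH A = normH A ** 1.
Proof. by move=> hA; rewrite scalemx1; apply: mulmx_adjH. Qed.

(** By [adjH_sqr], A^# is a polynomial in A and so commutes with A. *)
Lemma adjH_mul A : is_hermitian A -> adjH A * A = normH A ** 1.
Proof.
move=> hA; rewrite -mul_adjH // adjH_sqr // !ca_expand.
by rewrite !(scalemx_mull, scalemx_mulr) mulrA mulr1 mul1r.
Qed.

Lemma adjHD A B : adjH (A + B) = adjH A + adjH B + cross A B.
Proof. by rewrite !cross_unlock /crossH; by_functionals. Qed.

Lemma mul_cross A B : is_hermitian A -> is_hermitian B ->
  A * cross A B + B * adjH A = pairH (adjH A) B ** 1.
Proof.
move=> hA hB; have hN := hermitianN hB.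
have adjN : adjH (- B) = adjH B by rewrite scalemxN adjHZ // sqrrN expr1n !scale1r.
have normN : normH (- B) = - normH B.
  apply: scalar3_inj; rewrite -mul_adjH // adjN mulNr mul_adjH //.
  by by_functionals.
(* Subtracting x x^# = n(x) at A - B from the same identity at A + B keeps the parts odd in B. The
   cubic part cancels by B B^# = n(B), leaving twice the claim. *)
have := mul_adjH (hermitianD hA hN); have := mul_adjH (hermitianD hA hB).
rewrite !adjHD adjN normHD // normHD // adjN normN !(scalemxN B) pairHZr //.
rewrite crossZr //; move: (mul_adjH hA) (mul_adjH hB).
move: (cross A B) (adjH A) (adjH B) (pairH (adjH A) B) (pairH A (adjH B)).
move: (normH A) (normH B) => n m X A' B' p q AA' BB'.
rewrite !ca_expand !scalemx_mull !scalemx_mulr AA' BB' => E1 E2.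
apply: mx3_mulr2_inj; apply: mx3_functionals => g gZ.
move: (congr1 g E1) (congr1 g E2); rewrite !(raddfD g, raddfMn g, gZ) /=.
by move=> H1 H2; apply: (eq_lincomb (p := 1) (q := -1) H1 H2); ring.
Qed.

Lemma scalemx_center r U : (r ** 1) * U = r ** U.
Proof. by rewrite scalemx_mull mul1r. Qed.

(** Mirror image of [mul_cross]: expanded into words, the two left-hand sides agree. *)
Lemma cross_mul A B : is_hermitian A -> is_hermitian B ->
  cross A B * A + adjH A * B = pairH (adjH A) B ** 1.
Proof.
move=> hA hB; rewrite -mul_cross // crossE // adjH_sqr //.
move: (trace3 A) (trace3 B) (pairH A B) (sigma2 A) => t s p u.
rewrite !ca_expand !scalemx_mull !scalemx_mulr !mul1r !mulr1 !mulrA.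
by_functionals.
Qed.

Lemma trace3_adjH A : trace3 (adjH A) = sigma2 A.
Proof. by rewrite /trace3 /sigma2 /adjH !herm3E; ring. Qed.

(** Expand A^# × B by [crossE], with t(A^#) = s(A), and eliminate the scalar (A^#, B) through
    [cross_mul]. *)
Lemma cross_adjH A B : is_hermitian A -> is_hermitian B ->
  cross (adjH A) B = pairH A B ** A - A * B * A.
Proof.
move=> hA hB; have := cross_mul hA hB.
rewrite !crossE ?trace3_adjH //; last exact: adjH_hermitian.
move: (pairH (adjH A) B) => q; rewrite adjH_sqr //.
move: (trace3 A) (trace3 B) (pairH A B) (sigma2 A) => t u p s.
rewrite !ca_expand !scalemx_mull !scalemx_mulr !mul1r !mulr1 !mulrA => E.
apply: mx3_functionals => g gZ; move: (congr1 g E).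
rewrite !(raddfD g, raddfN g, gZ) /= => H.
by apply: (eq_lincomb (p := 1) (q := 0) H H); ring.
Qed.

(** Linearization of [cross_adjH] in its first argument. *)
Lemma cross_cross A B Z : is_hermitian A -> is_hermitian B -> is_hermitian Z ->
  cross (cross A B) Z = pairH A Z ** B + pairH B Z ** A - A * Z * B - B * Z * A.
Proof.
move=> hA hB hZ; have hAB := hermitianD hA hB.
have hX := cross_hermitian hA hB.
have := cross_adjH hAB hZ; rewrite adjHD crossC !crossDr //;
  do ?[exact: adjH_hermitian | by apply: hermitianD => //; exact: adjH_hermitian].
rewrite !(crossC Z) !cross_adjH // pairHDl //.
move: (cross (cross A B) Z) (pairH A Z) (pairH B Z) => X p q.
rewrite !ca_expand => E.
apply: mx3_functionals => g gZ; move: (congr1 g E).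
rewrite !(raddfD g, raddfN g, gZ) /= => H.
by apply: (eq_lincomb (p := 1) (q := 0) H H); ring.
Qed.

(** Polarizing [cross_mul] gives (A × X, Y) = (A × Y) X + (X × Y) A + (A × X) Y, which makes the
    trilinear form symmetric. *)
Lemma pairH_cross A B Z : is_hermitian A -> is_hermitian B -> is_hermitian Z ->
  pairH (cross A B) Z = pairH (cross A Z) B.
Proof.
move=> hA hB hZ; apply: scalar3_inj.
have E X Y : is_hermitian X -> is_hermitian Y -> pairH (cross A X) Y ** 1 =
    cross A Y * X + cross X Y * A + cross A X * Y.
  move=> hX hY; have hAX := hermitianD hA hX.
  have := cross_mul hAX hY; rewrite adjHD (crossC (A + X)) !crossDr //.
  have hAX' := cross_hermitian hA hX.
  rewrite !pairHDl //; do ?[exact: adjH_hermitian |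
     by apply: hermitianD => //; exact: adjH_hermitian].
  move: (cross_mul hA hY) (cross_mul hX hY); rewrite !(crossC Y).
  move: (pairH _ _) (pairH _ _) (pairH _ _) => p q r.
  move: (cross A Y) (cross X Y) (cross A X) (adjH A) (adjH X) => U V W A' X'.
  rewrite !ca_expand => E1 E2 E3; apply: mx3_functionals => g gZ.
  move: (congr1 g E1) (congr1 g E2) (congr1 g E3).
  rewrite !(raddfD g, gZ) /= => H1 H2 H3.
  by apply: (eq_lincomb (p := -1) (q := 1) H3 (f_equal2 +%R H1 H2)); ring.
by rewrite !E // [cross Z B]crossC; by_functionals.
Qed.

Lemma pairH_adjH A : is_hermitian A -> pairH (adjH A) A = 3%:R * normH A.
Proof.
move=> hA; apply: scalar3_inj; rewrite -cross_mul // cross_diag //.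
by rewrite (mulrnAl (adjH A)) adjH_mul //; by_functionals.
Qed.

(** Twice the left-hand side is A^# × A^#, which [cross_adjH] turns into 3 n(A) A - n(A) A. *)
Lemma adjHK A : is_hermitian A -> adjH (adjH A) = normH A ** A.
Proof.
move=> hA; have hA' := adjH_hermitian A; apply: mx3_mulr2_inj.
rewrite -cross_diag // cross_adjH // pairHC pairH_adjH // mul_adjH //.
rewrite scalemx_center; by_functionals.
Qed.

End Cross.

(** * Pairs of Hermitian matrices *)

Section PairIdentities.
Variables A B : 'M[C]_3.
Hypotheses (hA : is_hermitian A) (hB : is_hermitian B).
Local Notation Ad := (adjH A).
Local Notation Bd := (adjH B).
Local Notation G := (cross A B).
Local Notation P := (cross Ad Bd).
Local Notation a := (normH A).
Local Notation b := (pairH Ad B).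
Local Notation c := (pairH A Bd).
Local Notation d := (normH B).

Let hAd : is_hermitian Ad := adjH_hermitian A.
Let hBd : is_hermitian Bd := adjH_hermitian B.
Let hG : is_hermitian G := cross_hermitian hA hB.
Let hP : is_hermitian P := cross_hermitian hAd hBd.

(** This relation, [cross_mulB] and the products with P below reduce any product of A^#, B^# or G
    with A, B or P to a combination of 1, A^# B and B^# A. These are the products occurring in Y
    X. *)
Lemma cross_mulA : G * A = b ** 1 - Ad * B.
Proof. by rewrite -(cross_mul hA hB) addrK. Qed.

Lemma cross_mulB : G * B = c ** 1 - Bd * A.
Proof. by rewrite crossC [c]pairHC -(cross_mul hB hA) addrK. Qed.

Lemma mulA_cross : A * G = b ** 1 - B * Ad.
Proof. by rewrite -(mul_cross hA hB) addrK. Qed.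

Lemma mulB_cross : B * G = c ** 1 - A * Bd.
Proof. by rewrite crossC [c]pairHC -(mul_cross hB hA) addrK. Qed.

(** Two shapes of P, one with A and one with B at both ends; each product below uses the shape in
    which A^# A or B^# B appears. *)
Lemma cross_adjE : (P = c ** A - A * Bd * A) * (P = b ** B - B * Ad * B).
Proof. by rewrite {2}crossC !cross_adjH // [pairH B Ad]pairHC. Qed.

(** The first of six relations showing that left multiplication by A^# B and B^# A, hence by the
    image of S_r, preserves the span of A^#, B^# and G, where Y has its components. *)
Lemma adjA_B_adjA : Ad * B * Ad = b ** Ad - a ** G.
Proof.
have -> : Ad * B * Ad = b ** Ad - Ad * A * G.
  rewrite -[Ad * A * G]mulrA mulA_cross mulrBr scalemx_mulr mulr1 opprB subrKC.
  by rewrite -mulrA.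
by rewrite adjH_mul // scalemx_center.
Qed.

Lemma adjB_A_adjB : Bd * A * Bd = c ** Bd - d ** G.
Proof.
have -> : Bd * A * Bd = c ** Bd - Bd * B * G.
  rewrite -[Bd * B * G]mulrA mulB_cross mulrBr scalemx_mulr mulr1 opprB subrKC.
  by rewrite -mulrA.
by rewrite adjH_mul // scalemx_center.
Qed.

Lemma adjA_B_adjB : Ad * B * Bd = d ** Ad.
Proof. by rewrite -mulrA mul_adjH // scalemx_mulr mulr1. Qed.

Lemma adjB_A_adjA : Bd * A * Ad = a ** Bd.
Proof. by rewrite -mulrA mul_adjH // scalemx_mulr mulr1. Qed.

Lemma adjA_B_cross : Ad * B * G = c ** Ad - a ** Bd.
Proof.
rewrite -mulrA mulB_cross mulrBr mulrA adjH_mul // scalemx_center.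
by rewrite scalemx_mulr mulr1.
Qed.

Lemma adjB_A_cross : Bd * A * G = b ** Bd - d ** Ad.
Proof.
rewrite -mulrA mulA_cross mulrBr mulrA adjH_mul // scalemx_center.
by rewrite scalemx_mulr mulr1.
Qed.

Lemma adjA_mulP : Ad * P = (a * c) ** 1 - a ** (Bd * A).
Proof.
rewrite cross_adjE.1 mulrBr !mulrA scalemx_mulr adjH_mul // scalemx_center.
by rewrite scalemx_mull; by_functionals.
Qed.

Lemma adjB_mulP : Bd * P = (b * d) ** 1 - d ** (Ad * B).
Proof.
rewrite cross_adjE.2 mulrBr !mulrA scalemx_mulr adjH_mul // scalemx_center.
by rewrite scalemx_mull; by_functionals.
Qed.

Lemma cross_mulP : G * P = (b * c + a * d) ** 1 - c ** (Ad * B) - b ** (Bd * A).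
Proof.
rewrite cross_adjE.1 mulrBr !mulrA scalemx_mulr cross_mulA.
rewrite 2!mulrBl adjA_B_adjB !scalemx_mull !mul1r adjH_mul //; by_functionals.
Qed.

Lemma crossPA : cross P A = a ** Bd + c ** Ad.
Proof.
rewrite cross_cross // pairH_adjH // [pairH Bd A]pairHC adjB_A_adjA.
by rewrite adjH_mul // scalemx_center; by_functionals.
Qed.

Lemma crossPB : cross P B = d ** Ad + b ** Bd.
Proof.
rewrite cross_cross // pairH_adjH // adjA_B_adjB.
by rewrite adjH_mul // scalemx_center; by_functionals.
Qed.

Lemma adjH_P : adjH P = (a * c) ** Bd + (b * d) ** Ad - (a * d) ** G.
Proof.
apply: mx3_mulr2_inj => //; rewrite -cross_diag // cross_cross //.
(* Symmetry of the trilinear form gives (A^#, P) = (A^# × A^#, B^#) = 2 (A^##, B^#), and A^## = n(A)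
   A. *)
have pAd : pairH Ad P = 2%:R * (a * c).
  rewrite pairHC pairH_cross // cross_diag // adjHK // mulr2n.
  by rewrite pairHDl ?pairHZl //; [ring | exact: hermitianZ..].
have pBd : pairH Bd P = 2%:R * (b * d).
  rewrite crossC pairHC pairH_cross // cross_diag // adjHK // mulr2n.
  by rewrite pairHDl ?pairHZl // ?[pairH B _]pairHC; [ring | exact: hermitianZ..].
rewrite pAd pBd adjA_mulP adjB_mulP 2!mulrBl !scalemx_mull !mul1r.
by rewrite adjA_B_adjA adjB_A_adjB; by_functionals.
Qed.

End PairIdentities.

(** * Component identities for X, Y and S_r over abstract matrices *)

Section PairComponents.
Variables (a b c d : R) (A B Ad Bd G P : 'M[C]_3).
(* Coefficients of X and Y on (1, omega, theta), and the images of this basis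
   under S_r; the arguments stand for A, B, A^#, B^#, A * B and A^# * B^#. *)
Definition compX (i : 'I_3) : 'M[C]_3 := nth 0 [:: P; B; - A] i.
Definition compY (i : 'I_3) : 'M[C]_3 := nth 0
  [:: (b * d - c ^+ 2) ** Ad + (a * c - b ^+ 2) ** Bd
        + (b * c - 3%:R * a * d) ** G;
      (- 3%:R * d) ** Ad + (- b) ** Bd + c ** G;
      c ** Ad + (3%:R * a) ** Bd + (- b) ** G] i.
Definition compS (i : 'I_3) : 'M[C]_3 := nth 0 [:: 1; - (Ad * B); Bd * A] i.

End PairComponents.

Section Products.
Variables (a b c d : R) (A B Ad Bd G P : 'M[C]_3).
Local Notation f := (CubicForm a b c d).
Local Notation cst := (cubic_cst f).
Local Notation X := (compX A B P).
Local Notation Y := (compY a b c d Ad Bd G).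
Local Notation S := (compS A B Ad Bd).

(** Up to the factor Q, the numbers [dual_cst f k j] are the coordinates of the dual basis vector
    with index j, so the right-hand side collects the components of Q epsilon. *)
Lemma compY_mul_compX :
  Ad * A = a ** 1 -> Bd * B = d ** 1 ->
  G * A = b ** 1 - Ad * B -> G * B = c ** 1 - Bd * A ->
  Ad * P = (a * c) ** 1 - a ** (Bd * A) ->
  Bd * P = (b * d) ** 1 - d ** (Ad * B) ->
  G * P = (b * c + a * d) ** 1 - c ** (Ad * B) - b ** (Bd * A) ->
  forall k : 'I_3, \sum_(i < 3) \sum_(j < 3) cst i j k ** (Y i * X j) =
    \sum_(j < 3) dual_cst f k j ** S j.
Proof.
move=> E1 E2 E3 E4 E5 E6 E7.
by elim/ord3P; rewrite !sum3 /compX /compY /compS /= !mulrDl !scalemx_mull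
  ?(mulrN, E1, E2, E3, E4, E5, E6, E7); by_functionals.
Qed.

(** Once each S(v_l) acts on Y as multiplication by v_l, the left factor acts as Q times the sum of
    the v_l w_l, and that sum is 1. *)
Lemma dual_compS_mul_compY :
  Ad * B * Ad = b ** Ad - a ** G -> Ad * B * Bd = d ** Ad ->
  Ad * B * G = c ** Ad - a ** Bd ->
  Bd * A * Ad = a ** Bd -> Bd * A * Bd = c ** Bd - d ** G ->
  Bd * A * G = b ** Bd - d ** Ad ->
  forall k : 'I_3, \sum_(i < 3) \sum_(j < 3)
    cst i j k ** ((\sum_(l < 3) dual_cst f i l ** S l) * Y j) = disc f ** Y k.
Proof.
move=> E1 E2 E3 E4 E5 E6.
(* S(t) Y = t Y *)
have SE : forall l j, S l * Y j = \sum_(m < 3) cst l m j ** Y m.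
  do 2!elim/ord3P; rewrite !sum3 /compY /compS /= ?mul1r ?mulNr ?mulrDr
  ?scalemx_mulr ?(E1, E2, E3, E4, E5, E6); by_functionals.
(* The sum of the w_l v_l is the unit of L; cleared of denominators, it multiplies each basis vector
   by Q. *)
have key (k m : 'I_3) : \sum_(i < 3) \sum_(j < 3) \sum_(l < 3)
    cst i j k * (dual_cst f i l * cst l m j) = disc f * (k == m)%:R.
  by elim/ord3P: k; elim/ord3P: m; rewrite !sum3 /=; ring.
move=> k; transitivity (\sum_(m < 3) (\sum_(i < 3) \sum_(j < 3) \sum_(l < 3)
    cst i j k * (dual_cst f i l * cst l m j)) ** Y m); last first.
  under eq_bigr => m _ do rewrite key.
  rewrite (bigD1 k) // big1 => [|m /negPf km]; first by
    rewrite eqxx mulr1; apply: addr0.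
  by rewrite [k == m]eq_sym km mulr0 !scale0r.
under [RHS]eq_bigr => m _.
  rewrite !scaler_suml; under eq_bigr => i _.
    rewrite !scaler_suml; under eq_bigr => j _ do rewrite !scaler_suml.
    over.
  over.
rewrite [RHS]exchange_big; apply: eq_bigr => i _.
rewrite [RHS]exchange_big; apply: eq_bigr => j _.
rewrite mulr_suml scaler_sumr [RHS]exchange_big; apply: eq_bigr => l _.
rewrite scalemx_mull SE !scaler_sumr.
by apply: eq_bigr => m _; by_functionals.
Qed.

(** [KA], [KB], [KG] stand for A^# × H, B^# × H and (A × B) × H. The hypotheses are instances of x h
    x = (x, h) x - x^# × h and its polarization; cancellation of the [K] terms in the cubic ring is
    the vanishing of X^#. *)
Lemma compX_sandwich (H KA KB KG : 'M[C]_3) (pA pB pP : R) :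
  A * H * A = pA ** A - KA -> B * H * B = pB ** B - KB ->
  P * H * P = pP ** P - ((a * c) ** KB + (b * d) ** KA - (a * d) ** KG) ->
  A * H * B = pA ** B + pB ** A - B * H * A - KG ->
  P * H * A = pP ** A + pA ** P - A * H * P - (a ** KB + c ** KA) ->
  P * H * B = pP ** B + pB ** P - B * H * P - (d ** KA + b ** KB) ->
  forall k : 'I_3, \sum_(i < 3) \sum_(j < 3) cst i j k ** (X i * H * X j) =
    \sum_(i < 3) \sum_(j < 3)
      (cst i j k * nth 0 [:: pP; pB; - pA] i) ** X j.
Proof.
move=> E1 E2 E3 E4 E5 E6.
by elim/ord3P; rewrite !sum3 /compX /= !(mulNr, mulrN, E1, E2, E3, E4, E5, E6);
  by_functionals.
Qed.

End Products.

(** Polarized because a row over C ⊗ T has several components over C, which [rank_one_polar] takes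
    in pairs. *)
Lemma pairH_rows (x : 'M[C]_3) (u w : 'rV[C]_3) : is_hermitian x ->
  (pairH x (ctrmx (@ca_star R C) u *m w + ctrmx (@ca_star R C) w *m u))%:A =
  (u *m x *m ctrmx (@ca_star R C) w + w *m x *m ctrmx (@ca_star R C) u) 0 0.
Proof.
move=> hx; set h := _ + _.
have hE i j : h i j = (u 0 i)^* * w 0 j + (w 0 i)^* * u 0 j.
  by rewrite /h !mxE !big_ord1 !mxE.
have dh i : scal (h i i) = trC (u 0 i * (w 0 i)^* ).
  by rewrite trCC -trC_star hE /trC !ca_starM !ca_starK.
have tr3 (y s t : C) : trC (y^* * (s^* * t)) = trC (s * y * t^* ).
  by rewrite -trC_star !ca_starM !ca_starK -mulrA trCC.
have -> : pairH x h = hc1 x * trC (u 0 0 * (w 0 0)^* )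
    + hc2 x * trC (u 0 1 * (w 0 1)^* ) + hc3 x * trC (u 0 2 * (w 0 2)^* )
    + (trC (u 0 1 * ha1 x * (w 0 2)^* ) + trC (w 0 1 * ha1 x * (u 0 2)^* ))
    + (trC (u 0 2 * ha2 x * (w 0 0)^* ) + trC (w 0 2 * ha2 x * (u 0 0)^* ))
    + (trC (u 0 0 * ha3 x * (w 0 1)^* ) + trC (w 0 0 * ha3 x * (u 0 1)^* )).
  rewrite /pairH /(hc1 h) /(hc2 h) /(hc3 h) !dh /(ha1 h) /(ha2 h) /(ha3 h) !hE.
  rewrite !ca_starD !ca_starM !ca_starK [x 0 2](_ : _ = (ha2 x)^* );
    last by rewrite ca_starK.
  by rewrite !mulrDr !trCD !tr3; ring.
have xE i j : x i j = herm3 (hc1 x) (hc2 x) (hc3 x) (ha1 x) (ha2 x) (ha3 x) i j.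
  by rewrite -hermitian_herm3.
rewrite !scalerDl -!scalerA !trCE !mxE !sum3 !mxE !sum3 !xE.
move: (hc1 x) (hc2 x) (hc3 x) (ha1 x) (ha2 x) (ha3 x) => r1 r2 r3 x1 x2 x3.
rewrite !mxE /= !ca_starM !ca_starK !mulrDl -!scalerAr -!scalerAl !mulr1.
by rewrite !mulrA; by_functionals.
Qed.

(** * The elements X and Y of J ⊗ T *)

Section PairElements.
Variables (A B : 'M[C]_3).
Hypotheses (hA : is_hermitian A) (hB : is_hermitian B).
Local Notation f := (form_AB A B).
Local Notation T := (cubic_alg f R^o).
Local Notation CT := (cubic_alg f C).
Local Notation Ad := (adjH A).
Local Notation Bd := (adjH B).
Local Notation G := (cross A B).
Local Notation P := (cross Ad Bd).
Local Notation a := (normH A).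
Local Notation b := (pairH Ad B).
Local Notation c := (pairH A Bd).
Local Notation d := (normH B).
Local Notation X := (compX A B P).
Local Notation Y := (compY a b c d Ad Bd G).
Local Notation S := (compS A B Ad Bd).

Lemma compX_hermitian i : is_hermitian (X i).
Proof.
have hAd := adjH_hermitian A; have hBd := adjH_hermitian B.
have hP := cross_hermitian hAd hBd; have hN := hermitianN hA.
by elim/ord3P: i.
Qed.

Lemma compY_hermitian i : is_hermitian (Y i).
Proof.
have hAd := adjH_hermitian A; have hBd := adjH_hermitian B.
have hG := cross_hermitian hA hB.
by elim/ord3P: i; (do 2?[apply: hermitianD]; apply: hermitianZ).
Qed.

Lemma mcf_elt_X k : mcf (elt_X A B) k = X k.
Proof.
rewrite /elt_X !mcfD mcfN !mcf_tens !cf_tbasis -cross_unlock.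
by elim/ord3P: k; rewrite /compX /= ?scale0r ?scale1r ?oppr0 ?add0r ?addr0.
Qed.

(** Half of X ×_T X given without division, so that it lives over C ⊗ T; [crossT_elt_X] and
    [elt_YLE] link it to [elt_YL]. *)
Definition elt_Y : 'M[CT]_3 := \matrix_(i, j) mkE f (fun k => Y k i j).

Lemma mcf_elt_Y k : mcf elt_Y k = Y k.
Proof. by apply/matrixP => i j; rewrite !mxE cfE. Qed.

(** By symmetry six cross products among P, B and - A remain, and all of them lie in the span of
    A^#, B^# and A × B. *)
Lemma crossT_elt_X : crossT (elt_X A B) (elt_X A B) = elt_Y *+ 2.
Proof.
have hAd := adjH_hermitian A; have hBd := adjH_hermitian B.
apply: mcfP => k; rewrite mulr2n mcfD mcf_elt_Y /crossT mcf_sum.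
transitivity (\sum_(i < 3) \sum_(j < 3) tcross_cst f i j k ** cross (X i) (X j)).
  apply: eq_bigr => i _; rewrite mcf_sum; apply: eq_bigr => j _.
  by rewrite mcf_tens cf_tcross !mcf_elt_X -cross_unlock.
have cN (x y : 'M[C]_3) :
    is_hermitian x -> is_hermitian y -> cross x (- y) = - cross x y.
  move=> hx hy; have -> : - y = (-1) ** y by exact: scalemxN.
  by rewrite crossZr // -scalemxN.
have hN := hermitianN hA; have hP := cross_hermitian hAd hBd.
rewrite !sum3 /compX /compY /=.
rewrite (crossC B P) (crossC (- A) P) (crossC (- A) B) !cN // (crossC (- A) A) cN //.
rewrite crossPA // crossPB // !cross_diag // adjH_P // (crossC B A).
move: G Ad Bd a b c d => G' A' B' a' b' c' d'.
by elim/ord3P: k => /=; by_functionals.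
Qed.

Lemma mcf_elt_YX k :
  mcf (elt_Y *m elt_X A B) k = \sum_(j < 3) dual_cst f k j ** S j.
Proof.
have hAd := adjH_hermitian A; have hBd := adjH_hermitian B.
rewrite mcfM -(@compY_mul_compX _ _ _ _ A B Ad Bd G P).
- by do 2!apply: eq_bigr => ? _; rewrite mcf_elt_X mcf_elt_Y.
- exact: adjH_mul.
- exact: adjH_mul.
- exact: cross_mulA.
- exact: cross_mulB.
- exact: adjA_mulP.
- exact: adjB_mulP.
- exact: cross_mulP.
Qed.

Lemma elt_YXY : elt_Y *m elt_X A B *m elt_Y = (disc f)%:A *: elt_Y.
Proof.
apply: mcfP => k; rewrite mcfM mcf_scaleA mcf_elt_Y.
rewrite -(@dual_compS_mul_compY _ _ _ _ A B Ad Bd G).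
- by do 2!apply: eq_bigr => ? _; rewrite mcf_elt_YX mcf_elt_Y.
- exact: adjA_B_adjA.
- exact: adjA_B_adjB.
- exact: adjA_B_cross.
- exact: adjB_A_adjA.
- exact: adjB_A_adjB.
- exact: adjB_A_cross.
Qed.

Lemma elt_X_sandwich (H : 'M[C]_3) : is_hermitian H ->
  elt_X A B *m tens H 1 *m elt_X A B =
  mkE f (fun k => (pairH (X k) H)%:A) *: elt_X A B.
Proof.
move=> hH; have hAd := adjH_hermitian A; have hBd := adjH_hermitian B.
have hG := cross_hermitian hA hB; have hP := cross_hermitian hAd hBd.
have pN : pairH (- A) H = - pairH A H.
  have -> : - A = (-1) ** A by exact: scalemxN.
  by rewrite pairHZl // mulN1r.
apply: mcfP => k; rewrite mcfM mcf_scale.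
transitivity (\sum_(i < 3) \sum_(j < 3) cubic_cst f i j k ** (X i * H * X j)).
  by do 2!apply: eq_bigr => ? _; rewrite mcf_mul_tens1 !mcf_elt_X.
rewrite (@compX_sandwich _ _ _ _ A B P H (cross Ad H) (cross Bd H) (cross G H)
  (pairH A H) (pairH B H) (pairH P H)).
- have pE (i : 'I_3) :
      pairH (X i) H = nth 0 [:: pairH P H; pairH B H; - pairH A H] i.
    by elim/ord3P: i; rewrite /compX /= ?pN.
  do 2!apply: eq_bigr => ? _; rewrite cfE mcf_elt_X -pE.
  by rewrite [RHS]scalerA -scalerAl mul1r scalerA.
- by rewrite cross_adjH // opprB subrKC.
- by rewrite cross_adjH // opprB subrKC.
- rewrite -[LHS](subKr (pairH P H ** P)) -cross_adjH // adjH_P //; congr (_ - _).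
  rewrite crossC [- _]scalemxN !crossDr ?crossZr //; do ?apply: hermitianZ => //.
    by rewrite !(crossC H); by_functionals.
  by apply: hermitianD; apply: hermitianZ.
- by rewrite cross_cross //; by_functionals.
(* By [crossPA] the correction term is (P × A) × H, so [cross_cross] gives the relation; the last
   case does the same with P × B. *)
- have -> : a ** cross Bd H + c ** cross Ad H = cross (cross P A) H.
    rewrite crossPA // [RHS]crossC crossDr ?crossZr ?(crossC H) //;
    exact: hermitianZ.
  by rewrite cross_cross //; by_functionals.
- have -> : d ** cross Ad H + b ** cross Bd H = cross (cross P B) H.
    rewrite crossPB // [RHS]crossC crossDr ?crossZr ?(crossC H) //;
    exact: hermitianZ.
  by rewrite cross_cross //; by_functionals.
Qed.

End PairElements.

(** * X is of rank one *)

Section Rows.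
Variables (f : cubic_form R).
Local Notation T := (cubic_alg f R^o).
Local Notation CT := (cubic_alg f C).
Local Notation starC := (@ca_star R C).

Definition star_T (z : CT) : CT := mkE f (fun k => (cf z k)^* ).

Lemma mcf_ctrmx m n (Z : 'M[CT]_(m, n)) k :
  mcf (ctrmx star_T Z) k = ctrmx starC (mcf Z k).
Proof. by apply/matrixP => i j; rewrite !mxE cfE. Qed.

Lemma ca_star0 : (0 : C)^* = 0.
Proof. by have := ca_starZ 0 (0 : C); rewrite !scale0r. Qed.

Lemma ca_star_sum (I : Type) (r : seq I) (p : pred I) (g : I -> C) :
  (\sum_(i <- r | p i) g i)^* = \sum_(i <- r | p i) (g i)^*.
Proof. exact: (big_morph starC (@ca_starD R C) ca_star0). Qed.

Lemma ctrmxM m n p (U : 'M[C]_(m, n)) (V : 'M[C]_(n, p)) :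
  ctrmx starC (U *m V) = ctrmx starC V *m ctrmx starC U.
Proof.
apply/matrixP => i j; rewrite !mxE ca_star_sum; apply: eq_bigr => k _.
by rewrite !mxE ca_starM.
Qed.

(** [star_T] is trivial on T, so reversing products also needs commutativity of T, supplied by
    [cubic_cstC]. *)
Lemma ctrmx_starM m n p (Z : 'M[CT]_(m, n)) (Z' : 'M[CT]_(n, p)) :
  ctrmx star_T (Z *m Z') = ctrmx star_T Z' *m ctrmx star_T Z.
Proof.
apply: mcfP => k; rewrite mcf_ctrmx !mcfM exchange_big /=.
apply/matrixP => r s; rewrite !mxE !summxE ca_star_sum; apply: eq_bigr => i _.
rewrite !summxE ca_star_sum; apply: eq_bigr => j _.
rewrite !mcf_ctrmx -ctrmxM cubic_cstC !mxE.
by rewrite -!scalerAl !mul1r ca_starZ.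
Qed.

(* The basis (1, omega, theta) as central elements of C (x) T. *)
Definition zeta (p : 'I_3) : CT := mkE f (fun k => (k == p)%:R).

Lemma zetaC p (z : CT) : zeta p * z = z * zeta p.
Proof.
apply: cfP => k; rewrite !cfE exchange_big; apply: eq_bigr => i _.
apply: eq_bigr => j _; rewrite cubic_cstC !cfE.
by case: eqP; rewrite ?(mul1r, mulr1, mul0r, mulr0).
Qed.

Lemma star_zeta p (z : CT) : star_T (zeta p * z) = zeta p * star_T z.
Proof.
apply: cfP => k; rewrite !cfE ca_star_sum; apply: eq_bigr => i _.
rewrite ca_star_sum; apply: eq_bigr => j _; rewrite !cfE ca_starZ.
by case: eqP; rewrite ?(mul1r, mul0r, ca_star0).
Qed.

Lemma star_TD (z z' : CT) : star_T (z + z') = star_T z + star_T z'.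
Proof. by apply: cfP => k; rewrite !(cfD, cfE) ca_starD. Qed.

Lemma mcf_zeta m n p (Z : 'M[CT]_(m, n)) k : mcf (zeta p *: Z) k =
  \sum_(j < 3) ((cubic_cst f p j k)%:A : C) *: mcf Z j.
Proof.
rewrite mcf_scale (big_only1 p) // => [|i /negPf ip _].
  by apply: eq_bigr => j _; rewrite cfE eqxx scale1r.
by rewrite big1 // => j _; rewrite cfE ip scale0r scaler0.
Qed.

Lemma zeta_decomp m n (Z : 'M[CT]_(m, n)) :
  Z = \sum_p zeta p *: tens (mcf Z p) (1 : T).
Proof.
have zE p k : mcf (zeta p *: tens (mcf Z p) (1 : T)) k = (p == k)%:R *: mcf Z p.
  rewrite mcf_zeta (big_only1 0) // => [|j /negPf j0 _].
    rewrite mcf_tens cfE (cubic_cst0 f p k).2 eqxx !scale1r.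
    by case: eqP; rewrite ?scale1r ?scale0r.
  by rewrite mcf_tens cfE j0 !scale0r scaler0.
apply: mcfP => k; rewrite mcf_sum (big_only1 k) // => [|p /negPf pk _].
  by rewrite zE eqxx scale1r.
by rewrite zE pk scale0r.
Qed.

Lemma zeta_mulmx m n q p (Z : 'M[CT]_(m, n)) (Z' : 'M[CT]_(n, q)) :
  Z *m (zeta p *: Z') = zeta p *: (Z *m Z').
Proof.
apply/matrixP => i j; rewrite !mxE mulr_sumr; apply: eq_bigr => k _.
by rewrite !mxE !mulrA zetaC.
Qed.

Lemma ctrmx_zeta m n p (Z : 'M[CT]_(m, n)) :
  ctrmx star_T (zeta p *: Z) = zeta p *: ctrmx star_T Z.
Proof. by apply/matrixP => i j; rewrite !mxE star_zeta. Qed.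

Lemma ctrmx_starD m n (Z Z' : 'M[CT]_(m, n)) :
  ctrmx star_T (Z + Z') = ctrmx star_T Z + ctrmx star_T Z'.
Proof. by apply/matrixP => i j; rewrite !mxE star_TD. Qed.

Lemma ctrmx_tens1 m n (U : 'M[C]_(m, n)) :
  ctrmx star_T (tens U (1 : T)) = tens (ctrmx starC U) (1 : T).
Proof.
by apply: mcfP => k; rewrite mcf_ctrmx !mcf_tens; apply/matrixP => i j;
  rewrite !mxE -!scalerAl !mul1r ca_starZ.
Qed.

Lemma ctrmx_hermitian (Z : 'M[CT]_3) :
  (forall k, is_hermitian (mcf Z k)) -> ctrmx star_T Z = Z.
Proof. by move=> hZ; apply: mcfP => k; rewrite mcf_ctrmx; apply: hZ. Qed.

End Rows.

Section RankOne.
Variables (A B : 'M[C]_3).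
Hypotheses (hA : is_hermitian A) (hB : is_hermitian B).
Local Notation f := (form_AB A B).
Local Notation T := (cubic_alg f R^o).
Local Notation CT := (cubic_alg f C).
Local Notation X := (elt_X A B).
Local Notation ctr := (ctrmx (@star_T f)).

(** [elt_X_sandwich] at the Hermitian matrix u^* w + w^* u, whose entries lie in C. *)
Lemma rank_one_polar (u w : 'rV[C]_3)
    (U := tens u (1 : T)) (W := tens w (1 : T)) :
  X *m ctr U *m W *m X + X *m ctr W *m U *m X =
  ((W *m X *m ctr U) 0 0 + (U *m X *m ctr W) 0 0) *: X.
Proof.
pose H := ctrmx (@ca_star R C) u *m w + ctrmx (@ca_star R C) w *m u.
have hH : is_hermitian H.
  apply/matrixP => i j; rewrite /H !mxE !big_ord1 !mxE ca_starD !ca_starM !ca_starK.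
  by rewrite addrC.
have eH : tens H (1 : T) = ctr U *m W + ctr W *m U.
  apply: mcfP => k; rewrite mcfD !mcf_mul_tens1 !ctrmx_tens1 !mcf_tens scalerDr.
  by rewrite -!scalemxAl.
have := elt_X_sandwich hA hB hH.
rewrite eH mulmxDr mulmxDl !mulmxA => ->; congr (_ *: _).
apply: cfP => k; rewrite cfE pairH_rows; last exact: compX_hermitian.
rewrite cfD.
have E (x y : 'rV[C]_3) : cf ((tens x (1 : T) *m X *m ctr (tens y (1 : T))) 0 0) k
    = (x *m compX A B (cross (adjH A) (adjH B)) k *m ctrmx (@ca_star R C) y) 0 0.
  rewrite ctrmx_tens1 -mcf_elt_X // -mcf_tens1_mul -mcf_mul_tens1.
  by rewrite [RHS]mxE.
by rewrite [LHS]mxE !E addrC.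
Qed.

Lemma CT_mulr2_eq0 (Z : 'M[CT]_3) : Z + Z = 0 -> Z = 0.
Proof.
move=> ZZ; apply: mcfP => k; apply: mx3_mulr2_inj.
by rewrite !mulr2n -!mcfD ZZ addr0.
Qed.

(* The difference of both sides is a Hermitian form in u; by [rank_one_polar] its
   matrix on the coefficients of u is antisymmetric, whereas T is commutative. *)
Lemma rank_one (u : 'rV[CT]_3) :
  X *m ctr u *m u *m X = (u *m X *m ctr u) 0 0 *: X.
Proof.
pose U p := tens (mcf u p) (1 : T).
pose E p q := X *m ctr (U p) *m U q *m X - (U q *m X *m ctr (U p)) 0 0 *: X.
have EE p q : E p q + E q p = 0.
  rewrite addrACA -opprD -scalerDl -rank_one_polar; exact: subrr.
have uE : u = \sum_q zeta f q *: U q by exact: zeta_decomp.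
have ctr_sum : ctr u = \sum_p zeta f p *: ctr (U p).
  by rewrite {1}uE !sum3 !ctrmx_starD !ctrmx_zeta.
suff D : X *m ctr u *m u *m X - (u *m X *m ctr u) 0 0 *: X =
    \sum_p \sum_q (zeta f p * zeta f q) *: E p q.
  apply/eqP; rewrite -subr_eq0; apply/eqP; apply: CT_mulr2_eq0.
  rewrite {1}D D [X in _ + X]exchange_big -big_split big1 //= => p _.
  rewrite -big_split big1 // => q _ /=.
  by rewrite [zeta f q * _]zetaC -scalerDr EE scaler0.
have E1 : X *m ctr u *m u *m X =
    \sum_p \sum_q (zeta f p * zeta f q) *: (X *m ctr (U p) *m U q *m X).
  rewrite ctr_sum mulmx_sumr !mulmx_suml; apply: eq_bigr => p _.
  rewrite zeta_mulmx -!scalemxAl {1}uE mulmx_sumr mulmx_suml scaler_sumr.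
  by apply: eq_bigr => q _; rewrite zeta_mulmx -scalemxAl scalerA.
have E2 : u *m X *m ctr u =
    \sum_p \sum_q (zeta f p * zeta f q) *: (U q *m X *m ctr (U p)).
  rewrite ctr_sum mulmx_sumr; apply: eq_bigr => p _.
  rewrite zeta_mulmx {1}uE !mulmx_suml scaler_sumr.
  by apply: eq_bigr => q _; rewrite -!scalemxAl scalerA.
rewrite E1 E2 summxE scaler_suml -sumrB; apply: eq_bigr => p _.
rewrite summxE scaler_suml -sumrB; apply: eq_bigr => q _.
by rewrite /E scalerBr mxE [in RHS]scalerA.
Qed.

End RankOne.

(** * Extension of scalars to L *)

Section Transfer.
Variables (A B : 'M[C]_3).
Hypotheses (hA : is_hermitian A) (hB : is_hermitian B).
Local Notation f := (form_AB A B).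
Local Notation fF := (form_ABF A B).
Local Notation T := (cubic_alg f R^o).
Local Notation L := (cubic_alg fF F^o).
Local Notation CT := (cubic_alg f C).
Local Notation CL := (cubic_alg fF (ca_frac C)).
Local Notation toCL := (@CT_to_CL R C A B).
Local Notation S := (compS A B (adjH A) (adjH B)).

Let cstF (i j k : 'I_3) : cubic_cst fF i j k = tofrac (cubic_cst f i j k).
Proof. exact: (cubic_cst_map (@tofrac R)). Qed.

Lemma S_rE (t : T) : S_r t = \sum_(j < 3) (cf t j : R) ** S j.
Proof. by rewrite sum3. Qed.

(** The tensor summing b_i ⊗ w_i does not depend on the basis, so its coordinates are those for (1,
    omega, theta), namely [dual_cst] divided by Q. *)
Lemma dual_sum (b : 'I_3 -> T) (w : 'I_3 -> L) : dual_bases b w ->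
  forall j k : 'I_3, tofrac (disc f) *
    (\sum_(i < 3) tofrac (cf (b i) j : R) * (cf (w i) k : F)) =
  tofrac (dual_cst f k j).
Proof.
(* [u] represents the j-th coordinate functional through the trace form: [trb] checks this on the
   b_i, and [tre] carries it over to (1, omega, theta). *)
case=> bP bw j k; pose u : L := \sum_i tofrac (cf (b i) j : R) *: w i.
rewrite -[X in _ * X]cf_lin_sum -/u -disc_map disc_cf.
have trb i : ttrace (T_to_L (b i) * u) = tofrac (cf (b i) j : R).
  rewrite ttrace_sumr (big_only1 i) // => [|l li _]; rewrite bw.
    by rewrite eqxx mulr1.
  by rewrite eq_sym (negPf li) mulr0.
have tre l : ttrace (tbasis fF l * u) = (j == l)%:R.
  have [c [cE _]] := bP (tbasis f l).
  have cb m : \sum_i tofrac (c i) * tofrac (cf (b i) m : R) = (m == l)%:R.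
    rewrite -(rmorph_nat (@tofrac R)) -(cf_tbasis f l m) cE cf_lin_sum rmorph_sum.
    by apply: eq_bigr => i _; rewrite rmorphM.
  have -> : tbasis fF l = \sum_i tofrac (c i) *: T_to_L (b i).
    apply: cfP => m; rewrite cf_lin_sum cf_tbasis -cb.
    by apply: eq_bigr => i _; rewrite cfE.
  by rewrite ttrace_suml -cb; apply: eq_bigr => i _; rewrite trb.
rewrite (big_only1 j) // => [|l lj _]; rewrite tre.
  by rewrite eqxx mulr1 dual_cst_map.
by rewrite eq_sym (negPf lj) mulr0.
Qed.

Lemma mcf_map m n (Z : 'M[CT]_(m, n)) k :
  mcf (map_mx toCL Z) k = map_mx (@ca_map R C) (mcf Z k).
Proof. by apply/matrixP => i j; rewrite !mxE cfE. Qed.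

Lemma toCL_mulmx m n p (Z : 'M[CT]_(m, n)) (Z' : 'M[CT]_(n, p)) :
  map_mx toCL (Z *m Z') = map_mx toCL Z *m map_mx toCL Z'.
Proof.
apply: mcfP => k; rewrite mcf_map !mcfM raddf_sum; apply: eq_bigr => i _.
rewrite raddf_sum; apply: eq_bigr => j _.
by rewrite cstF !mcf_map /= map_mxZ map_mxM ca_mapA.
Qed.

Lemma toCL_scale m n (z : CT) (Z : 'M[CT]_(m, n)) :
  map_mx toCL (z *: Z) = toCL z *: map_mx toCL Z.
Proof.
apply: mcfP => k; rewrite mcf_map !mcf_scale raddf_sum; apply: eq_bigr => i _.
rewrite raddf_sum; apply: eq_bigr => j _.
by rewrite cstF mcf_map cfE /= !map_mxZ ca_mapA.
Qed.

(** Both sides have the components given by [dual_cst] and S: the left by [dual_sum], the right by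
    [mcf_elt_YX]. *)
Lemma epsilonE (b : 'I_3 -> T) (w : 'I_3 -> L) : dual_bases b w ->
  ((tofrac (disc f))%:A : CL) *: epsilon b w =
  map_mx toCL (elt_Y A B *m elt_X A B).
Proof.
move=> bw; apply: mcfP => k; rewrite mcf_scaleA mcf_map mcf_elt_YX //.
have mapS (r : 'I_3 -> R) : map_mx (@ca_map R C) (\sum_j r j ** S j) =
    \sum_j ((tofrac (r j))%:A : ca_frac C) *: map_mx (@ca_map R C) (S j).
  by rewrite raddf_sum; apply: eq_bigr => j _ /=; rewrite map_mxZ ca_mapA.
pose y i : F := cf (w i) k.
have mt i (U : 'M[ca_frac C]_3) :
    mcf (tens U (w i)) k = ((y i)%:A : ca_frac C) *: U by exact: mcf_tens.
rewrite /epsilon mcf_sum scaler_sumr mapS.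
under eq_bigr => i _ do rewrite mt S_rE mapS scaler_sumr scaler_sumr.
rewrite exchange_big; apply: eq_bigr => j _.
rewrite -(dual_sum bw) -/y mulr_sumr !scaler_suml; apply: eq_bigr => i _.
rewrite -/(y i); move: (y i) (tofrac (disc f)) => z q.
apply/matrixP => r s; rewrite !mxE.
exact: scalarA_mul3.
Qed.

End Transfer.

(** * Rows, Y and conjugation over L *)

Section Final.
Variables (A B : 'M[C]_3).
Hypotheses (hA : is_hermitian A) (hB : is_hermitian B).
Local Notation f := (form_AB A B).
Local Notation fF := (form_ABF A B).
Local Notation T := (cubic_alg f R^o).
Local Notation CT := (cubic_alg f C).
Local Notation CL := (cubic_alg fF (ca_frac C)).
Local Notation toCL := (@CT_to_CL R C A B).
Local Notation starL := (@star_L R C A B).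

Lemma row_LE (v : 'rV[C]_3) : row_L A B v = map_mx toCL (tens v (1 : T)).
Proof.
apply: mcfP => k; rewrite mcf_map !mcf_tens map_mxZ ca_mapA.
by rewrite !cfE rmorph_nat.
Qed.

Lemma elt_YLE : elt_YL A B = map_mx toCL (elt_Y A B).
Proof.
apply: mcfP => k; rewrite /elt_YL crossT_elt_X // mcf_scaleA !mcf_map.
rewrite (mulr2n (elt_Y A B)) mcfD map_mxD -mulr2n -scaler_nat.
have -> : (2%:R : ca_frac C) = (2%:R : F)%:A by rewrite scaler_nat.
rewrite scalerA -scalerAl mul1r scalerA mulVf ?scale1r //.
exact: frac2_neq0.
Qed.

Lemma ctrmx_starL_map m n (Z : 'M[CT]_(m, n)) :
  ctrmx starL (map_mx toCL Z) = map_mx toCL (ctrmx (@star_T f) Z).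
Proof.
by apply/matrixP => i j; rewrite !mxE; apply: cfP => k; rewrite !cfE ca_map_star.
Qed.

Lemma ctrmx_starL_scaleA m n (q : F) (Z : 'M[CL]_(m, n)) :
  ctrmx starL ((q%:A : CL) *: Z) = (q%:A : CL) *: ctrmx starL Z.
Proof.
have s0 : ca_starF (0 : ca_frac C) = 0.
  by have := congr1 (@ca_map R C) ca_star0; rewrite ca_map_star rmorph0.
apply/matrixP => i j; rewrite !mxE -!scalerAl !mul1r; apply: cfP => k.
rewrite !(cfE, cfZ); have := std_linear (ca_starFP C) q (cf (Z j i) k) 0.
by rewrite s0 !addr0.
Qed.

Lemma scaleA_inj m n (q : F) (Z Z' : 'M[CL]_(m, n)) : q != 0 ->
  (q%:A : CL) *: Z = (q%:A : CL) *: Z' -> Z = Z'.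
Proof.
move=> q0 /(congr1 (fun V => ((q^-1)%:A : CL) *: V)).
by rewrite !scalerA -!scalerAl !mul1r !scalerA mulVf // !scale1r.
Qed.

Lemma toCL_scaleA m n r (Z : 'M[CT]_(m, n)) :
  map_mx toCL ((r%:A : CT) *: Z) = ((tofrac r)%:A : CL) *: map_mx toCL Z.
Proof.
by apply: mcfP => k; rewrite mcf_map !mcf_scaleA mcf_map map_mxZ ca_mapA.
Qed.

End Final.

End HermitianIdentities.

Theorem theorem6p10 (R : idomainType)
    (charF : [pchar {fraction R}] =i pred0)
    (C : comp_algebra R) (A B : 'M[C]_3)
    (hermA : is_hermitian A) (hermB : is_hermitian B)
    (discAB : disc (form_AB A B) != 0)
    (b : 'I_3 -> ring_T A B) (w : 'I_3 -> alg_L A B)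
    (dual_bw : dual_bases b w)
    (v : 'rV[C]_3) :
  let ve : 'rV[C_L C A B]_3 := row_L A B v *m epsilon b w in
  (tofrac (disc (form_AB A B)))%:A *: (ctrmx (@star_L R C A B) ve *m ve) =
  (row_L A B v *m elt_YL A B *m ctrmx (@star_L R C A B) (row_L A B v)) 0 0
    *: elt_XL A B.
Proof.
move=> ve; pose X := elt_X A B; pose Y := elt_Y A B.
pose q := tofrac (disc (form_AB A B)); rewrite -/q.
pose vT := tens v (1 : cubic_alg (form_AB A B) R^o).
pose ctr := fun m n => @ctrmx _ (@star_T R C (form_AB A B)) m n.
have qve : (q%:A : C_L C A B) *: ve = map_mx (@CT_to_CL R C A B) (vT *m Y *m X).
  rewrite /ve -mulmx_scaleA (epsilonE charF) // row_LE -mulmxA.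
  by rewrite [in RHS]toCL_mulmx.
have hX : ctr _ _ X = X.
  by apply: ctrmx_hermitian => k; rewrite mcf_elt_X; apply: compX_hermitian.
have hY : ctr _ _ Y = Y.
  by apply: ctrmx_hermitian => k; rewrite mcf_elt_Y; apply: compY_hermitian.
(* The left-hand side is X u^* u X with u = v Y, where [rank_one] applies; [elt_YXY] then simplifies
   the scalar v Y X Y v^*. *)
have E : ctr _ _ (vT *m Y *m X) *m (vT *m Y *m X) =
    ((disc (form_AB A B))%:A : C_T C A B) *: ((vT *m Y *m ctr _ _ vT) 0 0 *: X).
  rewrite {1}/ctr ctrmx_starM -/(ctr _ _ X) hX mulmxA rank_one //.
  rewrite ctrmx_starM -/(ctr _ _ Y) hY -/(ctr _ _ vT) scalerA; congr (_ *: _).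
  have -> : vT *m Y *m X *m (Y *m ctr _ _ vT) = vT *m (Y *m X *m Y) *m ctr _ _ vT.
    by rewrite !mulmxA.
  by rewrite elt_YXY // mulmx_scaleA -scalemxAl [LHS]mxE.
(* A second factor Q turns the left-hand side into the product of Q v epsilon with its conjugate
   transpose, which comes from C ⊗ T by [qve]. *)
apply: (scaleA_inj (q := q)); first by rewrite tofrac_eq0.
transitivity (map_mx (@CT_to_CL R C A B)
    (ctr _ _ (vT *m Y *m X) *m (vT *m Y *m X))).
  rewrite toCL_mulmx /ctr -ctrmx_starL_map -qve ctrmx_starL_scaleA.
  by rewrite mulmx_scaleA -scalemxAl.
rewrite E toCL_scaleA toCL_scale; congr (_ *: (_ *: _)).
by rewrite row_LE elt_YLE // ctrmx_starL_map -!toCL_mulmx [in RHS]mxE.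
Qed.
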